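(* Let $X$ be a real Banach space whose modulus of smoothness satisfies, for some $s\in(1,2]$ and some constant $C_X>0$, $$\rho_X(t)\le C_Xt^s\quad\text{for all }t>0.$$ Let $K\subset X$ be a nonempty compact set, $\{\alpha_n\}_{n\ge1}\subset(0,1]$, and $f\in X$ with $\|f\|_{\mathcal{L}_1(K)}<\infty$. Then for any run of the weak Chebyshev greedy algorithm (defined in the context) with input $K$, $f$, $N$, $\{\alpha_n\}$, the iterates satisfy, for every $1\le n\le N$, $$\|f-f_n\|\le2^{1+\frac1s}C_X^{\frac1s}(\alpha_1\cdots\alpha_n)^{-\frac1n}\,\delta_{X,n}\,n^{\frac1s-1}(n!V_n)^{\frac1n}\,\|f\|_{\mathcal{L}_1(K)}\,\varepsilon_n(\mathrm{co}(K)),$$ where $V_n=\pi^{n/2}/\Gamma(\frac n2+1)$ is the volume of the Euclidean unit ball in $\mathbb{R}^n$.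
   Context: $\|\cdot\|$ is the norm of $X$ and $X'$ is the dual space of $X$. Modulus of smoothness: $\rho_X(t)=\sup_{\|x\|=1,\ \|y\|=t}\{\frac12\|x+y\|+\frac12\|x-y\|-1\}$. Symmetric convex hull: $\mathrm{co}(K)$ is the closure in $X$ of $\{\sum_i c_ig_i:\ \sum_i|c_i|\le1,\ g_i\in K\}$ (finite sums). Entropy numbers: $\varepsilon_n(\mathrm{co}(K))=\inf\{\varepsilon>0:\ \mathrm{co}(K)\text{ is covered by }2^n\text{ balls of }X\text{ of radius }\varepsilon\}$. $\|f\|_{\mathcal{L}_1(K)}:=\inf\{\sum_i|c_i|:\ f=\sum_ic_ig_i,\ g_i\in K\text{ for each }i\}$, where the sums are finite or countable (convergent in $X$), with value $+\infty$ if no such representation exists. $\delta_{X,n}=\sup_{Y_n\subset X,\ \dim Y_n=n}\ \inf_{T}\|T\|_{Y_n\to\ell_2^n}\|T^{-1}\|_{\ell_2^n\to Y_n}$, where the infimum is over all linear isomorphisms $T:Y_n\to\ell_2^n$, and $\ell_2^n$ is $\mathbb{R}^n$ with the Euclidean norm. Peak functional: for $g\in X$, a peak functional $F_g\in X'$ is a bounded linear functional with $\|F_g\|_{X'}=1$ and $F_g(g)=\|g\|$. Weak Chebyshev greedy algorithm. Input: compact $K\subset X$, target $f\in X$, integer $N$, sequence $\{\alpha_n\}_{n\ge1}\subset(0,1]$. Set $f_0=0$ and $r_0=f$. For $n=1,\dots,N$: Step 1: take a peak functional $F_{r_{n-1}}$ for $r_{n-1}$. Step 2: select $g_n\in K$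 with $|F_{r_{n-1}}(g_n)|\ge\alpha_n\sup_{g\in K}|F_{r_{n-1}}(g)|$. Step 3: set $X_n=\mathrm{span}\{g_1,\dots,g_n\}$. Step 4: select $f_n\in X_n$ with $\|f-f_n\|=\inf_{g\in X_n}\|f-g\|$, and set $r_n=f-f_n$. *)

(* Defs.v *)
From mathcomp Require Export all_boot all_order all_algebra.
From mathcomp Require Export all_classical all_reals all_analysis.

Set Implicit Arguments.
Unset Strict Implicit.
Unset Printing Implicit Defensive.

Import Order.TTheory GRing.Theory Num.Theory.
Import numFieldNormedType.Exports.

Local Open Scope classical_set_scope.
Local Open Scope ring_scope.

(* Suprema and infima are taken in [\bar R], so that none of them depends on
   the default value of the real-valued [sup] and [inf]. *)

Definition modulus_of_smoothness (R : realType) (X : normedModType R) (t : R) :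
    \bar R :=
  ereal_sup [set z | exists x y : X, [/\ `|x| = 1, `|y| = t &
    z = (2^-1 * `|x + y| + 2^-1 * `|x - y| - 1)%:E]].

Definition sym_convex_hull (R : realType) (X : normedModType R) (K : set X) :
    set X :=
  closure [set x | exists (m : nat) (c : 'I_m -> R) (g : 'I_m -> X),
    [/\ forall i, K (g i), \sum_(i < m) `|c i| <= 1 &
        x = \sum_(i < m) c i *: g i]].

Definition entropy_number (R : realType) (X : normedModType R) (n : nat)
    (A : set X) : \bar R :=
  ereal_inf [set e%:E | e in [set e : R | 0 < e /\
    exists c : 'I_(2 ^ n)%N -> X, A `<=` \bigcup_i ball (c i) e]].

(* The first alternative gives the finite representations, the second one the
   countable ones; the value is [+oo] when there is no representation. *)
Definition L1_norm (R : realType) (X : normedModType R) (K : set X) (f : X) :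
    \bar R :=
  ereal_inf [set z |
    (exists (m : nat) (c : 'I_m -> R) (g : 'I_m -> X),
      [/\ forall i, K (g i), f = \sum_(i < m) c i *: g i &
          z = (\sum_(i < m) `|c i|)%:E])
    \/
    (exists (c : nat -> R) (g : nat -> X),
      [/\ forall i, K (g i),
          series (fun i => c i *: g i) @ \oo --> f &
          z = (\sum_(0 <= i <oo) `|c i|%:E)%E])].

(* [subspace_dim n Y]: Y is a linear subspace of X of dimension n. *)
Definition subspace_dim (R : realType) (X : normedModType R) (n : nat)
    (Y : set X) : Prop :=
  exists b : 'I_n -> X,
    (forall c : 'I_n -> R, \sum_(i < n) c i *: b i = 0 -> forall i, c i = 0) /\
    Y = [set x | exists c : 'I_n -> R, x = \sum_(i < n) c i *: b i].

Definition l2_norm (R : realType) (n : nat) (u : 'rV[R]_n) : R :=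
  Num.sqrt (\sum_(i < n) u ord0 i ^+ 2).

(* T is a linear isomorphism from the subspace Y onto R^n with inverse S.  The
   values of T outside Y are irrelevant; S is linear because T is. *)
Definition linear_iso (R : realType) (X : normedModType R) (n : nat)
    (Y : set X) (T : X -> 'rV[R]_n) (S : 'rV[R]_n -> X) : Prop :=
  [/\ forall (a : R) (x y : X), Y x -> Y y -> T (a *: x + y) = a *: T x + T y,
      forall x, Y x -> S (T x) = x,
      forall u, Y (S u) &
      forall u, T (S u) = u].

Definition norm_to_l2 (R : realType) (X : normedModType R) (n : nat)
    (Y : set X) (T : X -> 'rV[R]_n) : \bar R :=
  ereal_sup [set (l2_norm (T y))%:E | y in [set y | Y y /\ `|y| <= 1]].

Definition norm_from_l2 (R : realType) (X : normedModType R) (n : nat)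
    (S : 'rV[R]_n -> X) : \bar R :=
  ereal_sup [set `|S u|%:E | u in [set u | l2_norm u <= 1]].

Definition distance_to_l2 (R : realType) (X : normedModType R) (n : nat)
    (Y : set X) : \bar R :=
  ereal_inf [set z | exists (T : X -> 'rV[R]_n) (S : 'rV[R]_n -> X),
    linear_iso Y T S /\ z = (norm_to_l2 Y T * norm_from_l2 S)%E].

(* The supremum is over nonnegative quantities and is taken in [0, +oo]: it is
   0, not [-oo], when X has no subspace of dimension n. *)
Definition delta (R : realType) (X : normedModType R) (n : nat) : \bar R :=
  ereal_sup (0%E |` [set distance_to_l2 n Y | Y in
    [set Y : set X | subspace_dim n Y]]).

Definition dual_norm (R : realType) (X : normedModType R)
    (F : {linear X -> R^o}) : \bar R :=
  ereal_sup [set `|F x|%:E | x in [set x : X | `|x| <= 1]].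

Definition peak_functional (R : realType) (X : normedModType R) (g : X)
    (F : {linear X -> R^o}) : Prop :=
  [/\ continuous F, dual_norm F = 1%E & F g = `|g|].

(* span {g_1, ..., g_n} *)
Definition span_upto (R : realType) (X : normedModType R) (g : nat -> X)
    (n : nat) : set X :=
  [set x | exists c : nat -> R, x = \sum_(1 <= i < n.+1) c i *: g i].

(* [F n] is the peak functional used at step n.+1, for the residual
   [f - fn n]; [g n.+1] and [fn n.+1] are the element of K and the iterate
   selected at that step. *)
Record WCGA_run (R : realType) (X : normedModType R) (K : set X) (f : X)
    (N : nat) (alpha : nat -> R) (F : nat -> {linear X -> R^o})
    (g fn : nat -> X) : Prop := {
  wcga_init : fn 0%N = 0;
  wcga_peak : forall n, (n < N)%N -> peak_functional (f - fn n) (F n);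
  wcga_mem : forall n, (n < N)%N -> K (g n.+1);
  wcga_select : forall n, (n < N)%N ->
    ((alpha n.+1)%:E * ereal_sup [set `|F n h|%:E | h in K]
       <= `|F n (g n.+1)|%:E)%E;
  wcga_span : forall n, (n < N)%N -> span_upto g n.+1 (fn n.+1);
  wcga_best : forall n, (n < N)%N ->
    `|f - fn n.+1|%:E = ereal_inf [set `|f - h|%:E | h in span_upto g n.+1]
}.

Definition Gamma (R : realType) (x : R) : R :=
  \int[lebesgue_measure]_(t in `]0, +oo[) (t `^ (x - 1) * expR (- t)).

Definition unit_ball_volume (R : realType) (n : nat) : R :=
  pi `^ (n%:R / 2) / Gamma (n%:R / 2 + 1).

(* Main.v *)
From mathcomp Require Import ring lra.
From mathcomp Require Import measurable_realfun.
Require Import Defs.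
Import Order.TTheory GRing.Theory Num.Theory.
Import numFieldNormedType.Exports.
Local Open Scope classical_set_scope.
Local Open Scope ring_scope.

(** Write [r_k] for the residual [f - fn k], [a_k] for its norm, [L] for the
    [L1_norm] of [f], [X_k] for the span of the first [k] selected elements
    and [q = s / (s - 1)] for the exponent conjugate to [s].

    Smoothness gives a recursion.  The peak functional [F] of [r_k] vanishes
    on [X_k], because [fn k] is a best approximation there
    ([greedy_orthogonal]); hence [F f = a_k], and representing [f] by elements
    of [K] shows that the selected element satisfies
    [F (g k.+1) >= alpha a_k / L] up to sign ([greedy_select]).  Subtracting
    from [g k.+1] any [h] in [X_k] keeps this value and keeps the direction
    inside [X_(k+1)], so a step of optimal length along [g k.+1 - h] gives,
    as soon as [omega_k >= |g k.+1 - h|],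
      [a_(k+1)^(-q) >= a_k^(-q) + (2 C s)^(1 - q) (alpha / (L omega_k))^q]
    ([greedy_step]).  Summing over [k] and comparing the arithmetic and the
    geometric means ([rate_of_sum]) bounds [a_n] by
      [(2 C s)^(1/s) n^(1/s - 1) L (prod_k omega_k / alpha_k)^(1/n)].

    Volumes bound the product of the [omega_k].  If [a_n] is positive, the
    selected elements are independent.  Let [T] be an isomorphism of their
    span onto Euclidean space, with inverse [S].  Orthogonalizing the
    [T (g k)] in order produces elements [h] of [X_k] for which
    [omega_k = |S| ell_k] is allowed, the product of the [ell_k] being the
    absolute value of the determinant of the [T (g k)]
    ([orthogonalized_greedy]).  The image under [T] of the absolutely convex
    hull of the [g k] is a cross-polytope of volume [2 ^ n / n!] times that
    determinant.  It is covered by the images of the traces on the span of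
    [2 ^ n] balls of radius [eps]; comparing volumes gives
      [prod_k ell_k <= n! V_n (sqrt 2 |T| eps)^n]
    ([hull_covering_volume]).

    The factor [sqrt 2] comes from the centres of the balls, which need not
    lie in the span.  A ball of radius [eps] meets the span in a set whose
    image has diameter at most [2 |T| eps], and by Jung's theorem ([jung])
    this image lies, up to an arbitrarily small error, in a Euclidean ball
    whose radius is [sqrt 2] times half of that bound.  The loss is affordable
    because [s^(1/s) <= sqrt 2] for [1 < s <= 2], so that
    [sqrt 2 (2 s)^(1/s) <= 2^(1 + 1/s)] ([smoothness_constant]).

    The comparison of volumes in dimension [n] uses integrals over the real
    line only: once the vectors are in triangular position, a covering of a
    cross-polytope by balls restricts to coverings of its slices, and the
    inequality for the slices is integrated ([cross_polytope_covering]).  The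
    constants [V_n] enter through the recursion [unit_ball_volumeS], which
    follows from the Gaussian integral. *)

(** * Affine substitution on the real line *)

Section affine.
Context {R : realType}.
Notation mu := (@lebesgue_measure R).

(** The pushforward of the Lebesgue measure under [x |-> a * x + b], scaled by
    [a], agrees with the Lebesgue measure on half-open intervals. *)
Lemma ge0_integral_affine (a b : R) (f : R -> \bar R) :
  0 < a -> measurable_fun [set: R] f -> (forall x, (0 <= f x)%E) ->
  (\int[mu]_x f x = a%:E * \int[mu]_x f (a * x + b)%R)%E.
Proof.
move=> a0 mf f0.
pose phi (x : measurableTypeR R) : measurableTypeR R := a * x + b.
have mphi : measurable_fun [set: measurableTypeR R] phi.
  by apply: measurable_realfun.measurable_funD => //;
    exact: measurable_realfun.measurable_funM.
unshelve epose (pf :=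
  pushforward mu phi : {measure set (measurableTypeR R) -> \bar R}) => //.
pose nu := mscale (NngNum (ltW a0)) pf.
rewrite (@eq_measure_integral _ _ _ _ nu); last first.
  move=> A mA _; apply: lebesgue_measure_unique => // _ [[x y] _ <-] /=.
  rewrite /nu /mscale/= /pf /pushforward.
  have -> : phi @^-1` `]x, y] = `](x - b) / a, (y - b) / a]%classic.
    apply/seteqP; split => t /=; rewrite /phi !in_itv/= ltr_pdivrMr//
      ler_pdivlMr// ltrBlDr lerBrDr;
    by rewrite (mulrC a).
  rewrite !lebesgue_measure_itv/= !lte_fin ltr_pM2r ?invr_gt0// ltrD2r.
  case: ifPn => xy; last by rewrite mule0.
  by rewrite -!EFinB -EFinM; congr (_%:E); field; rewrite gt_eqF.
rewrite ge0_integral_mscale//= ge0_integral_pushforward//.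
Qed.
End affine.

(** * Slices of balls *)

Section half_power.
Context {R : realType}.
Notation mu := (@lebesgue_measure R).

(** The power [r_+ ^ (m / 2)]: up to the factor [V_m], the volume of the ball
    of squared radius [r] in dimension [m].  It vanishes at [r = 0] even for
    [m = 0], so that it corresponds to open balls in every dimension. *)
Definition hpow (m : nat) (r : R) : R := if 0 < r then r `^ (m%:R / 2) else 0.

Lemma hpow_ge0 m r : 0 <= hpow m r.
Proof. by rewrite /hpow; case: ifP => // _; exact: powR_ge0. Qed.

Lemma hpow_gt0 m r : 0 < r -> hpow m r = r `^ (m%:R / 2).
Proof. by rewrite /hpow => ->. Qed.

Lemma hpow0 r : 0 < r -> hpow 0 r = 1.
Proof. by move=> r0; rewrite hpow_gt0// mul0r powRr0. Qed.

Lemma hpow_le m : {homo hpow m : x y / x <= y}.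
Proof.
move=> x y xy; rewrite /hpow; case: ifP => x0; last exact: hpow_ge0.
have y0 := lt_le_trans x0 xy.
by rewrite y0 ge0_ler_powR ?nnegrE ?divr_ge0// ltW.
Qed.

Lemma measurable_hpow m : measurable_fun [set: R] (hpow m).
Proof. by apply: nondecreasing_measurable => //; exact: hpow_le. Qed.

(** The ratio [V_(m+1) / V_m]: the slice at height [x] of the unit ball in
    dimension [m + 1] is a ball of squared radius [1 - x ^ 2]. *)
Definition slice_integral m : \bar R := (\int[mu]_x (hpow m (1 - x ^+ 2))%:E)%E.

Lemma measurable_hpow_slice m (r a c : R) :
  measurable_fun [set: R] (fun x => (hpow m (r - (a * x - c) ^+ 2))%:E).
Proof.
apply/measurable_EFinP; apply: (measurableT_comp (measurable_hpow m)).
apply: measurable_funB => //; apply: measurable_funX.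
by apply: measurable_funB => //; apply: measurable_funM.
Qed.

Lemma hpowM m x y : 0 < x -> hpow m (x * y) = x `^ (m%:R / 2) * hpow m y.
Proof.
move=> x0; rewrite /hpow pmulr_rgt0//; case: ifPn => y0; last by rewrite mulr0.
by rewrite powRM ?ltW.
Qed.

(** Integrating the [m]-dimensional volumes of the slices of an ellipsoid with
    one rescaled axis; the substitution normalizes the ellipsoid to the unit
    ball. *)
Lemma integral_hpow_slice m (r a c : R) : 0 < a ->
  (\int[mu]_x (hpow m (r - (a * x - c) ^+ 2))%:E =
   (hpow m.+1 r / a)%:E * slice_integral m)%E.
Proof.
move=> a0; have [r0|r0] := leP r 0.
  rewrite /hpow ltNge r0/= mul0r mul0e integral0_eq// => x _.
  by rewrite ifF//; apply/negbTE; rewrite -leNgt; have := sqr_ge0 (a * x - c); lra.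
have sr : 0 < Num.sqrt r by rewrite sqrtr_gt0.
rewrite (@ge0_integral_affine _ (Num.sqrt r / a) (c / a)); last 3 first.
- by rewrite divr_gt0.
- exact: measurable_hpow_slice.
- by move=> x; rewrite lee_fin hpow_ge0.
under eq_integral.
  move=> x _.
  have -> : r - (a * (Num.sqrt r / a * x + c / a) - c) ^+ 2 = r * (1 - x ^+ 2).
    transitivity (r - Num.sqrt r ^+ 2 * x ^+ 2).
      by field; rewrite gt_eqF.
    by rewrite sqr_sqrtr ?ltW//; ring.
  rewrite hpowM// EFinM.
  over.
rewrite ge0_integralZl_EFin//; last 3 first.
- by move=> x _; rewrite lee_fin hpow_ge0.
- have := measurable_hpow_slice m 1 1 0; apply: eq_measurable_fun => x _.
  by rewrite mul1r subr0.
- exact: powR_ge0.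
rewrite muleA -EFinM; congr (_%:E * _)%E.
rewrite hpow_gt0// -powR12_sqrt ?ltW// mulrAC -powRD ?(gt_eqF r0) ?implybT//.
by congr (_ `^ _ / _); rewrite -[m.+1]addn1 natrD; lra.
Qed.

Lemma integral_hpow_sqr m (r : R) :
  (\int[mu]_x (hpow m (r - x ^+ 2))%:E =
   (hpow m.+1 r)%:E * slice_integral m)%E.
Proof.
rewrite -[hpow m.+1 r]divr1 -(@integral_hpow_slice m r 1 0 ltr01).
by apply: eq_integral => x _; rewrite mul1r subr0.
Qed.

End half_power.

(** * The recursion for the volumes of unit balls *)

Section ball_volume.
Context {R : realType}.
Notation mu := (@lebesgue_measure R).

(** The value [Gamma (m / 2 + 1)], as an extended real because its finiteness
    is only obtained by induction on [m]. *)
Definition half_Gamma m : \bar R :=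
  (\int[mu]_u (hpow m u * expR (- u))%:E)%E.

Lemma measurable_expRN : measurable_fun [set: R] (fun u => expR (- u)).
Proof. by apply: measurableT_comp => //; exact: measurable_funN. Qed.

Lemma half_Gamma_ge0 m : (0 <= half_Gamma m)%E.
Proof.
by apply: integral_ge0 => u _; rewrite lee_fin mulr_ge0 ?hpow_ge0 ?expR_ge0.
Qed.

Lemma slice_integral_ge0 m : (0 <= @slice_integral R m)%E.
Proof. by apply: integral_ge0 => u _; rewrite lee_fin hpow_ge0. Qed.

Lemma half_Gamma0 : half_Gamma 0 = 1%E.
Proof.
have -> : half_Gamma 0 = (\int[mu]_(u in `]0%R, +oo[) (expR (- u))%:E)%E.
  rewrite [RHS]integral_mkcond; apply: eq_integral => u _.
  rewrite patchE; rewrite mem_setE in_itv/= andbT; case: ifP => u0.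
    by rewrite hpow0 ?mul1r.
  by rewrite /hpow u0 mul0r.
rewrite integral_itv_obnd_cbnd; last first.
  apply/measurable_EFinP; apply: measurable_funTS; exact: measurable_expRN.
have dF (x : R) : is_derive x 1 (fun x : R => - expR (- x)) (expR (- x)).
  by apply: is_derive_eq; rewrite mulrN1 opprK.
rewrite (@ge0_continuous_FTC2y _ _ (fun x => - expR (- x)) 0 0).
- by rewrite oppr0 expR0 sub0e EFinN oppeK.
- by move=> x _; exact: expR_ge0.
- apply: continuous_subspaceT => x.
  by apply: continuous_comp; [exact: opp_continuous|exact: continuous_expR].
- by rewrite -oppr0; apply: cvgN; exact: cvgr_expR.
- by move=> x _; case: (dF x).
- apply: cvg_at_right_filter; apply: cvgN.
  by apply: continuous_comp; [exact: opp_continuous|exact: continuous_expR].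
- by move=> x _; rewrite derive1E; case: (dF x).
Qed.

(** Both sides are the integral of [exp (- u) (u - x ^ 2)_+ ^ (m / 2)] over the
    plane: for fixed [u] the inner integral is a slice integral, for fixed [x]
    the translation [u = v + x ^ 2] splits off the Gaussian. *)
Lemma slice_integral_half_Gamma m :
  (slice_integral m * half_Gamma m.+1 = (Num.sqrt pi)%:E * half_Gamma m)%E.
Proof.
pose f (z : measurableTypeR R * measurableTypeR R) : \bar R :=
  (hpow m (z.1 - z.2 ^+ 2) * expR (- z.1))%:E.
have f0 z : (0 <= f z)%E by rewrite lee_fin mulr_ge0 ?hpow_ge0 ?expR_ge0.
have mf : measurable_fun setT f.
  apply/measurable_EFinP; apply: measurable_funM.
    apply: (measurableT_comp (measurable_hpow m)).
    by apply: measurable_funB => //; apply: measurable_funX.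
  by apply: (measurableT_comp measurable_expRN).
have := @fubini_tonelli _ _ _ _ _ mu mu f mf f0.
have -> : (\int[mu]_x \int[mu]_y f (x, y) =
           slice_integral m * half_Gamma m.+1)%E.
  transitivity
    (\int[mu]_x (slice_integral m * (hpow m.+1 x * expR (- x))%:E))%E.
    apply: eq_integral => u _; rewrite /f/=.
    under eq_integral do rewrite mulrC EFinM.
    rewrite ge0_integralZl_EFin ?expR_ge0//; last 2 first.
    - by move=> x _; rewrite lee_fin hpow_ge0.
    - have := measurable_hpow_slice m u 1 0; apply: eq_measurable_fun => x _.
      by rewrite mul1r subr0.
    by rewrite integral_hpow_sqr muleA -EFinM muleC mulrC.
  rewrite ge0_integralZl//.
  - apply/measurable_EFinP; apply: measurable_funM; first exact: measurable_hpow.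
    exact: measurable_expRN.
  - by move=> x _; rewrite lee_fin mulr_ge0 ?hpow_ge0 ?expR_ge0.
  - exact: slice_integral_ge0.
move=> ->.
transitivity (\int[mu]_x (half_Gamma m * (gauss_fun x)%:E))%E.
  apply: eq_integral => x _; rewrite /f/=.
  rewrite (@ge0_integral_affine _ 1 (x ^+ 2))//; first last.
  - by move=> u; exact: (f0 (u, x)).
  - exact: (measurable_fun_pair1 x mf).
  rewrite mul1e.
  under eq_integral.
    move=> u _.
    rewrite mul1r addrK opprD expRD mulrA mulrC EFinM.
    over.
  rewrite ge0_integralZl_EFin ?expR_ge0//.
  - by rewrite muleC.
  - by move=> u _; rewrite lee_fin mulr_ge0 ?hpow_ge0 ?expR_ge0.
  - apply/measurable_EFinP; apply: measurable_funM; first exact: measurable_hpow.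
    exact: measurable_expRN.
rewrite ge0_integralZl ?half_Gamma_ge0//.
- by rewrite integralT_gauss muleC.
- by apply/measurable_EFinP; exact: measurable_gauss_fun.
- by move=> x _; rewrite lee_fin gauss_fun_ge0.
Qed.

Lemma ge0_mule_pos_fin (x y : \bar R) : (0 <= x)%E -> (0 <= y)%E ->
  (0 < x * y < +oo)%E -> (0 < x < +oo)%E && (0 < y < +oo)%E.
Proof.
move=> x0 y0 /andP[xy0 xyoo].
have {}x0 : (0 < x)%E.
  by rewrite lt0e x0 andbT; apply: contraL xy0 => /eqP ->; rewrite mul0e ltxx.
have {}y0 : (0 < y)%E.
  by rewrite lt0e y0 andbT; apply: contraL xy0 => /eqP ->; rewrite mule0 ltxx.
rewrite x0 y0 /=; apply/andP; split; rewrite ltey; apply: contraL xyoo => /eqP ->.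
  by rewrite gt0_mulye// ltxx.
by rewrite gt0_muley// ltxx.
Qed.

Lemma half_Gamma_pos_fin m : (0 < half_Gamma m < +oo)%E.
Proof.
elim: m => [|m IH]; first by rewrite half_Gamma0 lte01 ltry.
suff /(ge0_mule_pos_fin _ _ (slice_integral_ge0 m) (half_Gamma_ge0 m.+1)) :
    (0 < slice_integral m * half_Gamma m.+1 < +oo)%E by case/andP.
rewrite slice_integral_half_Gamma; case/andP: IH.
have : 0 < Num.sqrt (pi : R) by rewrite sqrtr_gt0 pi_gt0.
case: (half_Gamma m) => //= r sp r0 _.
by rewrite -EFinM lte_fin mulr_gt0//= ltry.
Qed.

Lemma Gamma_half m : (Gamma (m%:R / 2 + 1 : R))%:E = half_Gamma m.
Proof.
rewrite /Gamma /Rintegral.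
suff -> : (\int[mu]_(t in `]0%R, +oo[)
    (t `^ (m%:R / 2 + 1 - 1) * expR (- t))%:E)%E = half_Gamma m.
  have /andP[g0 goo] := half_Gamma_pos_fin m.
  by rewrite fineK// ge0_fin_numE// ltW.
rewrite integral_mkcond; apply: eq_integral => u _.
rewrite patchE addrK; rewrite mem_setE in_itv/= andbT; case: ifP => u0.
  by rewrite hpow_gt0.
by rewrite /hpow u0 mul0r.
Qed.

Lemma Gamma_half_gt0 m : 0 < Gamma (m%:R / 2 + 1 : R).
Proof. by rewrite -lte_fin Gamma_half; case/andP: (half_Gamma_pos_fin m). Qed.

Lemma unit_ball_volume_gt0 m : 0 < unit_ball_volume R m.
Proof. by rewrite divr_gt0 ?Gamma_half_gt0// powR_gt0// pi_gt0. Qed.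

Lemma unit_ball_volume0 : unit_ball_volume R 0 = 1.
Proof.
rewrite /unit_ball_volume; have := Gamma_half 0; rewrite half_Gamma0 => -[->].
by rewrite mul0r powRr0 divr1.
Qed.

(** Cavalieri for the unit ball, read off from the closed formula for [V_m]. *)
Lemma unit_ball_volumeS m :
  ((unit_ball_volume R m)%:E * slice_integral m = (unit_ball_volume R m.+1)%:E)%E.
Proof.
have := slice_integral_half_Gamma m; rewrite -!Gamma_half.
have G0 := Gamma_half_gt0 m; have G1 := Gamma_half_gt0 m.+1.
have := slice_integral_ge0 m.
case: (slice_integral m) => [k _|_|//]; last by rewrite gt0_mulye.
rewrite -!EFinM => -[kE]; congr (_%:E); rewrite /unit_ball_volume.
rewrite -[m.+1]addn1 natrD mulrDl powRD; last by rewrite (gt_eqF (pi_gt0 R)) implybT.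
rewrite mul1r powR12_sqrt ?pi_ge0//.
rewrite -[m.+1]addn1 natrD mulrDl mul1r in kE G1.
have -> : k = Num.sqrt pi * Gamma (m%:R / 2 + 1) / Gamma (m%:R / 2 + 2^-1 + 1).
  by rewrite -kE mulfK// gt_eqF.
by field; rewrite !gt_eqF.
Qed.

End ball_volume.

(** * Slices of cross-polytopes *)

Section tent.
Context {R : realType}.
Notation mu := (@lebesgue_measure R).

Lemma hpow_double m (w : R) : 0 < w -> hpow m.*2 w = w ^+ m.
Proof.
move=> w0; rewrite hpow_gt0// -powR_mulrn ?ltW//; congr (_ `^ _).
by rewrite -muln2 natrM mulfK.
Qed.

Lemma measurable_tent m (w : R) :
  measurable_fun [set: R] (fun t => (hpow m (w - `|t|))%:E).
Proof.
apply/measurable_EFinP; apply: (measurableT_comp (measurable_hpow m)).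
by apply: measurable_funB => //; exact: measurableT_comp.
Qed.

Lemma integral_itv_pow m (w : R) : 0 < w ->
  (\int[mu]_(t in `[0%R, w]) ((w - t) ^+ m)%R%:E = (w ^+ m.+1 / m.+1%:R)%:E)%E.
Proof.
move=> w0.
have dF (x : R) : is_derive x 1 (fun t : R => - m.+1%:R^-1 * (w - t) ^+ m.+1)
    ((w - x) ^+ m).
  have dw : is_derive x 1 (fun t : R => w - t) (- 1).
    by apply: is_derive_eq; rewrite add0r mul1r.
  have -> : (fun t : R => - m.+1%:R^-1 * (w - t) ^+ m.+1) =
      - m.+1%:R^-1 \*: (fun t : R => w - t) ^+ m.+1.
    by apply/funext => t; rewrite exprfctE.
  have := @is_deriveZ _ _ _ _ (- m.+1%:R^-1) _ _ _ (is_deriveX m.+1 dw).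
  by rewrite /GRing.scale/= mulrN1 mulrN mulNr opprK mulKf ?pnatr_eq0.
have cF (x : R) : {for x, continuous (fun t : R => - m.+1%:R^-1 * (w - t) ^+ m.+1)}.
  by apply/differentiable_continuous/derivable1_diffP; case: (dF x).
have cf (x : R) : {for x, continuous (fun t : R => (w - t) ^+ m)}.
  apply: (@continuous_comp _ _ _ (fun t : R => w - t) (fun t => t ^+ m)).
    by apply: cvgB; [exact: cvg_cst|exact: cvg_id].
  exact: exprn_continuous.
rewrite (@continuous_FTC2 _ _ (fun t : R => - m.+1%:R^-1 * (w - t) ^+ m.+1))//.
- rewrite subrr expr0n/= mulr0 subr0 -EFinB; congr (_%:E).
  by rewrite sub0r mulNr opprK mulrC.
- exact: continuous_subspaceT.
- split=> [x _||]; first by case: (dF x).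
  + by apply: cvg_at_right_filter; exact: cF.
  + by apply: cvg_at_left_filter; exact: cF.
- by move=> x _; rewrite derive1E; case: (dF x).
Qed.

(** The slice at height [t] of a cross-polytope of radius [w] is a
    cross-polytope of radius [w - |t|]; this is where the factor [2 / (m + 1)]
    of the volume [2 ^ m / m!] comes from.  The exponent is written [m.*2]
    because [hpow] takes half of it. *)
Lemma integral_tent m (w : R) :
  (\int[mu]_t (hpow m.*2 (w - `|t|))%:E =
   (2 / m.+1%:R * hpow m.+1.*2 w)%:E)%E.
Proof.
have mf := measurable_tent m.*2 w.
have [w0|w0] := leP w 0.
  rewrite /hpow [X in if X then _ else _]ltNge w0/= mulr0 integral0_eq// => x _.
  by rewrite ifF//; apply/negbTE; rewrite -leNgt; have := normr_ge0 x; lra.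
have E : (\int[mu]_(t in `]0%R, +oo[) (hpow m.*2 (w - `|t|))%:E =
    (w ^+ m.+1 / m.+1%:R)%:E)%E.
  transitivity (\int[mu]_(t in `]0%R, w[) ((w - t) ^+ m)%R%:E)%E.
    rewrite [LHS]integral_mkcond [RHS]integral_mkcond.
    apply: eq_integral => t _; rewrite !patchE !mem_setE !in_itv/= andbT.
    case: ltP => //= t0; rewrite gtr0_norm//; case: ltP => tw.
      by rewrite hpow_double// subr_gt0.
    by rewrite /hpow ltNge subr_le0 tw.
  rewrite -integral_itv_pow//.
  have mp : measurable_fun [set: R] (fun t : R => ((w - t) ^+ m)%:E).
    apply/measurable_EFinP; apply: measurable_funX; exact: measurable_funB.
  rewrite integral_itv_obnd_cbnd ?integral_itv_bndo_bndc//;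
    exact: measurable_funTS.
rewrite -(setUv [set` `]-oo, (0:R)]]) setCitvl ge0_integral_setU//=.
- rewrite E; suff -> : (\int[mu]_(t in `]-oo, 0%R]) (hpow m.*2 (w - `|t|))%:E =
      \int[mu]_(t in `[0%R, +oo[) (hpow m.*2 (w - `|t|))%:E)%E.
    rewrite -integral_itv_obnd_cbnd ?E; last exact: measurable_funTS.
    by rewrite -EFinD hpow_double//; congr (_%:E); ring.
  rewrite [RHS]ge0_integration_by_substitution0//; last first.
    by move=> t; rewrite lee_fin hpow_ge0.
  by apply: eq_integral => t _; rewrite normrN.
- exact: measurable_funTS.
- by move=> t _; rewrite lee_fin hpow_ge0.
- by apply/disj_setPS => t []; rewrite /= !in_itv/= andbT => t0 /lt_geF; rewrite t0.
Qed.
End tent.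

(** * Covering a cross-polytope by balls *)

Section covering.
Context {R : realType}.
Notation mu := (@lebesgue_measure R).

(** Cavalieri, by induction on the dimension.  Fixing the last coordinate
    [t = y n] leaves a cross-polytope of radius [w - |t|] in dimension [n]; as
    the last column of [A] only involves [y n], the slices of the balls are
    balls, with centres and radii depending on [t].  The radii have to be
    arbitrary, possibly negative numbers for this induction.  Both sides of
    the inequality for the slices are then integrated over [t].  Indices are
    natural numbers so that passing from [n] to [n.+1] needs no
    reindexing. *)
Lemma cross_polytope_covering (n M : nat) (A : nat -> nat -> R)
    (c : 'I_M -> nat -> R) (r : 'I_M -> R) (w : R) :
  (forall i k, (i < k < n)%N -> A i k = 0) ->
  (forall i, (i < n)%N -> 0 < A i i) ->
  (forall y : nat -> R, \sum_(i < n) `|y i| < w ->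
     exists j, \sum_(k < n) (\sum_(i < n) y i * A i k - c j k) ^+ 2 < r j) ->
  2 ^+ n / n`!%:R * (\prod_(i < n) A i i) * hpow n.*2 w <=
  \sum_(j < M) unit_ball_volume R n * hpow n (r j).
Proof.
elim: n c r w => [|n IH] c r w Alow Apos cover.
  rewrite expr0 fact0 divr1 big_ord0 !mul1r.
  have sum_ge0 : 0 <= \sum_(j < M) unit_ball_volume R 0 * hpow 0 (r j).
    by apply: sumr_ge0 => j _; rewrite mulr_ge0 ?hpow_ge0// ltW// unit_ball_volume_gt0.
  have [w0|w0] := leP w 0; first by rewrite /hpow ltNge w0.
  have [|j] := cover (fun=> 0); first by rewrite big_ord0.
  rewrite big_ord0 => rj.
  rewrite (bigD1 j)//= unit_ball_volume0 mul1r !hpow0// lerDl.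
  by apply: sumr_ge0 => i _; rewrite mul1r hpow_ge0.
have An0 : 0 < A n n by exact: Apos.
have slice (t : R) :
    2 ^+ n / n`!%:R * (\prod_(i < n) A i i) * hpow n.*2 (w - `|t|) <=
    \sum_(j < M) unit_ball_volume R n * hpow n (r j - (A n n * t - c j n) ^+ 2).
  apply: (IH (fun j k => c j k - t * A n k)) => [i k /andP[ik kn]|i ilt|y ylt].
  - by apply: Alow; rewrite ik ltnW.
  - by apply: Apos; exact: ltnW.
  have := cover (fun i => if i == n then t else y i).
  rewrite big_ord_recr/= eqxx.
  under eq_bigr => i _ do rewrite ltn_eqF//.
  rewrite -ltrBrDr => /(_ ylt)[j]; rewrite big_ord_recr/= => rj; exists j.
  rewrite ltrBrDr; apply: le_lt_trans rj.
  rewrite le_eqVlt; apply/orP; left; apply/eqP; congr (_ + _).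
    apply: eq_bigr => k _; rewrite big_ord_recr/= eqxx opprB addrA.
    by under [in RHS]eq_bigr => i _ do rewrite ltn_eqF//.
  rewrite big_ord_recr/= eqxx big1 ?add0r ?(mulrC t)// => i _.
  by rewrite Alow ?ltn_ord ?ltnSn// mulr0.
have c0 : 0 <= 2 ^+ n / n`!%:R * \prod_(i < n) A i i.
  apply: mulr_ge0; first by rewrite divr_ge0 ?exprn_ge0.
  by apply: prodr_ge0 => i _; rewrite ltW// Apos// ltnW// ltnS.
have V0 := ltW (@unit_ball_volume_gt0 R n).
have : (\int[mu]_t (2 ^+ n / n`!%:R * (\prod_(i < n) A i i) *
      hpow n.*2 (w - `|t|))%R%:E <=
    \int[mu]_t (\sum_(j <- enum 'I_M)
      (unit_ball_volume R n * hpow n (r j - (A n n * t - c j n) ^+ 2))%R%:E)%R)%E.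
  apply: ge0_le_integral => //.
  - by move=> t _; rewrite lee_fin mulr_ge0 ?hpow_ge0.
  - apply/measurable_EFinP; apply: measurable_funM => //.
    by apply/measurable_EFinP; exact: measurable_tent.
  - apply: emeasurable_sum => j; apply/measurable_EFinP; apply: measurable_funM => //.
    by apply/measurable_EFinP; exact: measurable_hpow_slice.
  - by move=> t _; rewrite sumEFin lee_fin big_enum/=; exact: slice.
under eq_integral do rewrite EFinM.
rewrite ge0_integralZl_EFin//; last 2 first.
- by move=> t _; rewrite lee_fin hpow_ge0.
- exact: measurable_tent.
rewrite integral_tent ge0_integral_sum//; last 2 first.
- move=> j; apply/measurable_EFinP; apply: measurable_funM => //.
  by apply/measurable_EFinP; exact: measurable_hpow_slice.
- by move=> j t _; rewrite lee_fin mulr_ge0 ?hpow_ge0.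
under [X in (_ <= X)%E -> _]eq_bigr.
  move=> j _.
  under eq_integral do rewrite EFinM.
  rewrite ge0_integralZl_EFin//; last 2 first.
  - by move=> t _; rewrite lee_fin hpow_ge0.
  - exact: measurable_hpow_slice.
  rewrite integral_hpow_slice// muleCA unit_ball_volumeS -EFinM.
  over.
rewrite sumEFin -EFinM lee_fin big_enum/= big_ord_recr/=.
under [in X in _ <= X -> _]eq_bigr do rewrite mulrAC.
rewrite -mulr_suml ler_pdivlMr//; under [in X in _ <= X -> _]eq_bigr do rewrite mulrC.
apply: le_trans; rewrite le_eqVlt; apply/orP; left; apply/eqP.
rewrite factS natrM exprS; field.
by rewrite nat1r !pnatr_eq0 -!lt0n fact_gt0.
Qed.

End covering.

(** * Euclidean geometry and the theorem of Jung *)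

Section euclid.
Context {R : realType}.

Definition dotr n (u v : 'rV[R]_n) : R := \sum_(i < n) u 0 i * v 0 i.
Definition sqnorm n (u : 'rV[R]_n) : R := dotr n u u.
Arguments dotr {n}. Arguments sqnorm {n}.

Lemma dotrE n (u v : 'rV[R]_n) : u *m v^T = (dotr u v)%:M.
Proof.
apply/matrixP => i j; rewrite !ord1 !mxE eqxx mulr1n.
by apply: eq_bigr => k _; rewrite mxE.
Qed.

Lemma sqnormE n (u : 'rV[R]_n) : sqnorm u = \sum_(i < n) u 0 i ^+ 2.
Proof. by apply: eq_bigr => i _; rewrite expr2. Qed.

Lemma sqnorm_ge0 n (u : 'rV[R]_n) : 0 <= sqnorm u.
Proof. by rewrite sqnormE sumr_ge0// => i _; rewrite sqr_ge0. Qed.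

Lemma sqnorm_eq0 n (u : 'rV[R]_n) : (sqnorm u == 0) = (u == 0).
Proof.
rewrite sqnormE psumr_eq0 => [|i _]; last exact: sqr_ge0.
apply/allP/eqP => [h|-> i _]; last by rewrite /= mxE expr0n eqxx.
apply/rowP => i; rewrite mxE; apply/eqP; rewrite -sqrf_eq0.
exact: h (mem_index_enum i).
Qed.

Lemma sqnormBZ n (u v : 'rV[R]_n) t :
  sqnorm (u - t *: v) = sqnorm u - 2 * t * dotr u v + t ^+ 2 * sqnorm v.
Proof.
rewrite /sqnorm /dotr mulr_sumr mulr_sumr -sumrB -big_split/=.
by apply: eq_bigr => i _; rewrite !mxE; ring.
Qed.

Lemma sqnormM n (u : 'rV[R]_n) (Q : 'M[R]_n) :
  Q *m Q^T = 1%:M -> sqnorm (u *m Q) = sqnorm u.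
Proof.
move=> QQ; have : (sqnorm (u *m Q))%:M = (sqnorm u)%:M :> 'M[R]_1.
  by rewrite -!dotrE trmx_mul mulmxA -(mulmxA u) QQ mulmx1.
by move/matrixP/(_ 0 0); rewrite !mxE eqxx.
Qed.

(** Let [r] be the infimum of the squared radii of the balls enclosing [S].
    Take a nearly optimal centre [c] and a point [y] of [S] nearly at distance
    [sqrt r] from [c].  Moving [c] slightly towards [y] cannot help, so some
    point [x] of [S] stays nearly as far away; this forces [x - c] and [y - c]
    to have an almost nonpositive scalar product, hence [|x - y| ^ 2] to be
    at least almost [2 r], and so [2 r <= D]. *)
Lemma jung n (S : set 'rV[R]_n) (D eta : R) : 0 < eta ->
  (forall x y, S x -> S y -> sqnorm (x - y) <= D) ->
  exists c, forall x, S x -> sqnorm (x - c) < D / 2 + eta.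
Proof.
move=> eta0 diam.
have [->|/set0P[x0 Sx0]] := eqVneq S set0; first by exists 0.
have D0 : 0 <= D by apply: le_trans (diam x0 x0 Sx0 Sx0); exact: sqnorm_ge0.
pose E := [set rho : R | exists c, forall x, S x -> sqnorm (x - c) <= rho].
have infE : has_inf E.
  split; first by exists D, x0 => x Sx; exact: diam.
  by exists 0 => rho [c /(_ _ Sx0)]; apply: le_trans; exact: sqnorm_ge0.
set r := inf E.
have r0 : 0 <= r.
  apply: lb_le_inf; first exact: infE.1.
  by move=> rho [c /(_ _ Sx0)]; apply: le_trans; exact: sqnorm_ge0.
have far c (h : R) : 0 < h -> exists2 x, S x & r - h < sqnorm (x - c).
  move=> h0; apply: contrapT => far.
  suff /(ge_inf infE.2) : E (r - h) by rewrite -/r; lra.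
  exists c => x Sx; rewrite leNgt; apply/negP => ?; apply: far; by exists x.
suff rD : r <= D / 2.
  have [rho [c cP] rho_lt] := inf_adherent eta0 infE.
  by exists c => x /cP; rewrite -/r in rho_lt; lra.
rewrite leNgt; apply/negP => Dr.
(* [t] is the relative displacement of the centre; the errors below add up
   to at most [t * (r + 4)], half of the gap [2 * r - D]. *)
pose t := (2 * r - D) / (2 * (r + 4)).
have tE : t * (2 * (r + 4)) = 2 * r - D by rewrite /t divfK//; lra.
have t0 : 0 < t by rewrite divr_gt0; lra.
have t1 : t < 1 by rewrite ltr_pdivrMr; lra.
have h0 : 0 < t ^+ 2 by rewrite exprn_gt0.
have [rho [c cP] rho_lt] := inf_adherent h0 infE; rewrite -/r in rho_lt.
have [y Sy yfar] := far c _ h0.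
have [x Sx xfar] := far (c + t *: (y - c)) _ h0.
have xc := le_lt_trans (cP _ Sx) rho_lt.
have yc := le_lt_trans (cP _ Sy) rho_lt.
have xy := diam x y Sx Sy.
have E1 : x - (c + t *: (y - c)) = (x - c) - t *: (y - c) by rewrite opprD addrA.
have E2 : x - y = (x - c) - 1 *: (y - c) by rewrite scale1r opprB addrA subrK.
rewrite E1 sqnormBZ in xfar; rewrite E2 sqnormBZ in xy.
move: (sqnorm (x - c)) (sqnorm (y - c)) (dotr (x - c) (y - c)) yfar xfar xc yc xy.
move=> a b p yfar xfar xc yc xy.
have p_lt : 2 * p < 2 * t + t * b.
  by rewrite -(ltr_pM2l t0); nra.
nra.
Qed.

End euclid.
Arguments dotr {R n}. Arguments sqnorm {R n}.

(** * Orthogonal triangularization *)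

Section qr.
Context {R : realType}.

(** Unless [u] is already in the required position, [Q] is the reflection in
    the hyperplane orthogonal to the difference [v] of the two vectors. *)
Lemma householder n (u : 'rV[R]_n.+1) : exists Q : 'M[R]_n.+1,
  Q *m Q^T = 1%:M /\ u *m Q = Num.sqrt (sqnorm u) *: delta_mx 0 0.
Proof.
set g := Num.sqrt (sqnorm u); pose v := u - g *: delta_mx 0 0.
have [v0|v0] := eqVneq v 0.
  exists 1%:M; rewrite trmx1 !mulmx1; split => //.
  by apply/eqP; rewrite -subr_eq0 -/v v0.
have sv : sqnorm v != 0 by rewrite sqnorm_eq0.
have gg : g ^+ 2 = sqnorm u by rewrite sqr_sqrtr ?sqnorm_ge0.
pose P := v^T *m v.
have PP : P *m P = sqnorm v *: P.
  by rewrite /P mulmxA -(mulmxA v^T) dotrE mul_mx_scalar scalemxAl.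
pose Q := 1%:M - (2 / sqnorm v) *: P.
have QT : Q^T = Q by rewrite /Q linearB/= linearZ/= trmx1 trmx_mul trmxK.
exists Q; split.
  rewrite QT /Q mulmxBl mul1mx mulmxBr mulmx1 -scalemxAl -scalemxAr PP !scalerA.
  set k := 2 / _; have -> : k * k * sqnorm v = k + k by rewrite /k; field.
  by rewrite scalerDl opprB addrK subrK.
have d0 : dotr (delta_mx 0 0) (delta_mx 0 0 : 'rV[R]_n.+1) = 1.
  rewrite /dotr (bigD1 0)//= !mxE !eqxx mulr1 big1 ?addr0// => i /negbTE i0.
  by rewrite mxE i0 andbF mul0r.
have svE : sqnorm v = 2 * dotr u v.
  rewrite /v sqnormBZ -gg /sqnorm d0 mulr1.
  have -> : dotr u (u - g *: delta_mx 0 0) = g ^+ 2 - g * dotr u (delta_mx 0 0).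
    rewrite gg /sqnorm /dotr mulr_sumr -sumrB; apply: eq_bigr => i _.
    by rewrite !mxE; ring.
  ring.
rewrite /Q mulmxBr mulmx1 -scalemxAr mulmxA dotrE mul_scalar_mx scalerA.
have -> : 2 / sqnorm v * dotr u v = 1.
  by rewrite mulrAC -svE divff.
by rewrite scale1r opprB addrC subrK.
Qed.

(** A reflection sends the first row to a multiple of the first basis vector;
    the rest is an induction on the lower right block.  Nonnegativity of the
    diagonal makes its product the absolute value of the determinant. *)
Lemma qr_decomposition n (U : 'M[R]_n) : exists Q : 'M[R]_n,
  [/\ Q *m Q^T = 1%:M, is_trig_mx (U *m Q) & forall i, 0 <= (U *m Q) i i].
Proof.
elim: n U => [|n IH] U.
  exists 1%:M; split; first by rewrite trmx1 mulmx1.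
  - by apply/is_trig_mxP; case.
  - by case.
have [Q1 [Q1Q1 uQ1]] := householder _ (row 0 U).
have [W WE] : exists W : 'M[R]_(1 + n), W = U *m Q1 by exists (U *m Q1).
have rW : row 0 W = Num.sqrt (sqnorm (row 0 U)) *: delta_mx 0 0.
  by rewrite -uQ1 WE row_mul.
have [Q2 [Q2Q2 trig diag]] := IH (drsubmx W).
pose Q : 'M[R]_(1 + n) := block_mx 1%:M 0 0 Q2.
have WQ : W *m Q = block_mx (ulsubmx W) 0 (dlsubmx W) (drsubmx W *m Q2).
  rewrite -[W in LHS]submxK mulmx_block !mulmx0 !mulmx1 !addr0 !add0r.
  congr (block_mx _ _ _ _); rewrite [ursubmx W](_ : _ = 0) ?mul0mx//.
  apply/rowP => k; have /rowP/(_ (rshift 1 k)) := rW.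
  by rewrite !mxE eqxx/= mulr0 => <-; congr (W _ _); apply/val_inj.
exists (Q1 *m Q); split.
- rewrite trmx_mul mulmxA -(mulmxA Q1).
  have -> : Q *m Q^T = 1%:M.
    rewrite tr_block_mx mulmx_block !trmx0 !mulmx0 !mul0mx trmx1 mulmx1 !addr0 !add0r.
    by rewrite Q2Q2 -scalar_mx_block.
  by rewrite mulmx1.
- rewrite mulmxA -WE WQ.
  suff : is_trig_mx (block_mx (ulsubmx W) 0 (dlsubmx W) (drsubmx W *m Q2)) by [].
  rewrite is_trig_block_mx// eqxx trig andbT/=.
  by apply/is_trig_mxP => i j; rewrite !ord1.
- rewrite mulmxA -WE WQ.
  suff : forall i : 'I_(1 + n), 0 <= (block_mx (ulsubmx W) 0 (dlsubmx W)
    (drsubmx W *m Q2)) i i by [].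
  move=> i; case: (split_ordP i) => k ->.
    rewrite block_mxEul !ord1 mxE.
    have /rowP/(_ 0) := rW; rewrite !mxE !eqxx mulr1 => E.
    suff -> : W (lshift n 0) (lshift n 0) = Num.sqrt (sqnorm (row 0 U)) by exact: sqrtr_ge0.
    by rewrite -E; congr (W _ _); apply/val_inj.
  by rewrite block_mxEdr.
Qed.
End qr.

Section triangular.
Context {R : realType}.

(** Induction on [k]: a multiple of row [k] clears coordinate [k] without
    touching the later ones. *)
Lemma trig_mx_span n (L : 'M[R]_n) : is_trig_mx L -> (forall i, L i i != 0) ->
  forall (k : nat) (x : 'rV[R]_n), (forall i : 'I_n, (k <= i)%N -> x 0 i = 0) ->
  exists2 a : 'rV[R]_n, (forall i : 'I_n, (k <= i)%N -> a 0 i = 0) & x = a *m L.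
Proof.
move=> /is_trig_mxP Ltrig Lii; elim=> [|k IH] x xk.
  exists 0; first by move=> i _; rewrite mxE.
  by rewrite mul0mx; apply/rowP => i; rewrite mxE xk.
have [kn|nk] := ltnP k n; last first.
  have [i|a ak ->] := IH x; first by move=> ki; have := ltn_ord i; rewrite ltnNge (leq_trans nk ki).
  by exists a => // i /ltnW /ak.
pose i0 := Ordinal kn; pose c := x 0 i0 / L i0 i0.
have [i ki|a ak xE] := IH (x - c *: row i0 L).
  rewrite !mxE; move: ki; rewrite leq_eqVlt => /predU1P[ki|ki].
    have -> : i = i0 by apply/val_inj.
    by rewrite /c divfK// subrr.
  by rewrite xk// (Ltrig i0)// mulr0 subr0.
exists (a + c *: delta_mx 0 i0).
  move=> i ki; rewrite !mxE ak 1?ltnW// eqxx/=.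
  suff -> : (i == i0) = false by rewrite mulr0 addr0.
  by apply/negbTE; rewrite -val_eqE/= gtn_eqF.
by rewrite mulmxDl -xE -scalemxAl -rowE subrK.
Qed.

Lemma norm_det_orthogonal n (Q : 'M[R]_n) : Q *m Q^T = 1%:M -> `|\det Q| = 1.
Proof.
move=> QQ; have : \det Q * \det Q = 1 by rewrite -{2}det_tr -det_mulmx QQ det1.
move/(congr1 Num.norm); rewrite normrM normr1 -expr2 => /eqP.
by rewrite sqrp_eq1 ?normr_ge0// => /eqP.
Qed.

(** The left-hand side is the volume of the image of the cross-polytope, the
    right-hand side the total volume of the balls.  An orthogonal change of
    coordinates preserves the balls and makes [U] triangular. *)
Lemma det_covering n M (U : 'M[R]_n.+1) (z : 'I_M -> 'rV[R]_n.+1) (r : R) :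
  (forall y : 'rV[R]_n.+1, \sum_i `|y 0 i| < 1 ->
     exists j, sqnorm (y *m U - z j) < r) ->
  2 ^+ n.+1 / n.+1`!%:R * `|\det U| <=
    M%:R * (unit_ball_volume R n.+1 * hpow n.+1 r).
Proof.
move=> cover; have [d0|d0] := eqVneq (\det U) 0.
  by rewrite d0 normr0 mulr0 mulr_ge0 ?ler0n// mulr_ge0 ?hpow_ge0// ltW// unit_ball_volume_gt0.
have [Q [QQ trig diag]] := qr_decomposition _ U.
set L := U *m Q in trig diag.
have detL : \prod_i L i i = `|\det U|.
  rewrite -[LHS]ger0_norm; last by apply: prodr_ge0 => i _.
  rewrite -det_trig// det_mulmx normrM.
  by rewrite (norm_det_orthogonal _ _ QQ) mulr1.
have Lpos i : 0 < L i i.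
  rewrite lt0r diag andbT; apply: contra d0 => /eqP Li.
  by rewrite -normr_eq0 -detL (bigD1 i)//= Li mul0r.
pose A (i k : nat) := L (inord i) (inord k).
have AL (i k : 'I_n.+1) : A i k = L i k by rewrite /A !inord_val.
have := @cross_polytope_covering R n.+1 M A (fun j k => (z j *m Q) 0 (inord k))
  (fun=> r) 1.
under eq_bigr => i _ do rewrite AL.
rewrite detL hpow_double// expr1n mulr1 sumr_const card_ord mulr_natl; apply.
- move=> i k /andP[ik kn]; apply: (is_trig_mxP trig).
  by rewrite !inordK// (ltn_trans ik).
- by move=> i _; exact: Lpos.
- move=> y y1; have [|j zj] := cover (\row_i y i).
    by under eq_bigr do rewrite mxE.
  exists j; apply: le_lt_trans zj; rewrite -(sqnormM _ _ _ QQ) sqnormE.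
  rewrite le_eqVlt; apply/orP; left; apply/eqP; apply: eq_bigr => k _.
  rewrite mulmxBl -mulmxA -/L [in RHS]mxE inord_val; congr ((_ + _) ^+ 2).
    by rewrite mxE; apply: eq_bigr => i _; rewrite AL [(\row__ _) _ _]mxE.
  by rewrite [in RHS]mxE.
Qed.
End triangular.

(** * From a recursion on residuals to a rate *)

Section rate.
Context {R : realType}.

Lemma powRV (x q : R) : 0 <= x -> x^-1 `^ q = (x `^ q)^-1.
Proof. by move=> x0; rewrite -powR_inv1// -powRrM mulN1r powRN. Qed.

Lemma powRN_le (x y q : R) : 0 < q -> 0 < x -> 0 < y ->
  y `^ (- q) <= x `^ (- q) -> x <= y.
Proof.
move=> q0 x0 y0; rewrite !powRN lef_pV2 ?posrE ?powR_gt0// => h.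
rewrite leNgt; apply/negP => yx.
have : y `^ q < x `^ q by rewrite gt0_ltr_powR// nnegrE ltW.
by rewrite ltNge h.
Qed.

Lemma powR_prod (I : finType) (f : I -> R) q : (forall i, 0 <= f i) ->
  \prod_i f i `^ q = (\prod_i f i) `^ q.
Proof.
move=> f0; suff [_ //] : 0 <= \prod_i f i /\ \prod_i f i `^ q = (\prod_i f i) `^ q.
elim/big_rec2 : _ => [|i x y _ [x0 ->]]; first by rewrite powR1.
by split; [exact: mulr_ge0|rewrite powRM].
Qed.

(** [1 - z / q <= exp (- z / q)] raised to the power [q], followed by
    [exp (- z) <= 1 / (1 + z)]. *)
Lemma bernoulli_inv (q z : R) : 0 < q -> 0 <= z -> z < q ->
  1 + z <= (1 - z / q) `^ (- q).
Proof.
move=> q0 z0 zq; have h0 : 0 < 1 - z / q by rewrite subr_gt0 ltr_pdivrMr// mul1r.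
rewrite powRN -[leLHS]invrK lef_pV2 ?posrE ?invr_gt0 ?powR_gt0//; last by lra.
have h1 : 1 - z / q <= expR (- (z / q)) by rewrite -[leLHS]/(1 + _) expR_ge1Dx.
apply: (@le_trans _ _ (expR (- z))).
  have -> : - z = - (z / q) * q by rewrite mulNr divfK// gt_eqF.
  by rewrite expRM ge0_ler_powR ?nnegrE ?expR_ge0 ?(ltW q0) ?(ltW h0).
by rewrite expRN lef_pV2 ?posrE ?expR_gt0//; [exact: expR_ge1Dx|lra].
Qed.

Section exponents.
Variables s C : R.
Notation q := (s / (s - 1)).
Notation kappa := ((2 * C * s) `^ (- (q - 1))).

Lemma conjugate_gt1 : 1 < s -> 1 < q.
Proof. by move=> s1; rewrite ltr_pdivlMr; lra. Qed.

(** The value [x = (beta / (2 C s))^(q - 1)] minimizes the right-hand side of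
    the hypothesis, which becomes [a (1 - x beta / q)]; the Bernoulli
    inequality then turns the decrease of [a] into an increase of
    [a^(-q)]. *)
Lemma rate_step (a a' beta : R) : 1 < s -> 0 < C -> 0 < a -> 0 < a' -> 0 < beta ->
  (forall x, 0 < x -> a' <= a + 2 * C * a * x `^ s - x * a * beta) ->
  a `^ (- q) + kappa * (beta / a) `^ q <= a' `^ (- q).
Proof.
move=> s1 C0 a0 a'0 b0 h; have q1 := conjugate_gt1 s1.
have s0 : 0 < s by lra. have sm0 : 0 < s - 1 by lra.
have Cs0 : 0 < 2 * C * s by rewrite !mulr_gt0.
pose x := (beta / (2 * C * s)) `^ (q - 1).
have x0 : 0 < x by rewrite powR_gt0// divr_gt0.
have xs : 2 * C * x `^ s = x * beta / s.
  have -> : x `^ s = x * (beta / (2 * C * s)).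
    rewrite -[s in LHS](subrK 1) addrC powRD ?(gt_eqF x0) ?implybT//.
    rewrite powRr1 ?ltW//; congr (_ * _).
    rewrite /x -powRrM (_ : (q - 1) * (s - 1) = 1) ?powRr1//.
      by rewrite ltW// divr_gt0.
    by  field; rewrite gt_eqF.
  by field; rewrite !gt_eqF.
have qE : q^-1 = 1 - s^-1.
  by  field; rewrite !gt_eqF.
have {}h : a' <= a * (1 - x * beta / q).
  apply: le_trans (h _ x0) _; rewrite le_eqVlt; apply/orP; left; apply/eqP.
  rewrite -(mulrAC _ _ a) xs qE; ring.
have q0 : 0 < q by lra.
have z0 : 0 <= x * beta by rewrite mulr_ge0 ?ltW.
have zq : x * beta < q.
  have : 0 < a * (1 - x * beta / q) by exact: lt_le_trans h.
  by rewrite pmulr_rgt0// subr_gt0 ltr_pdivrMr// mul1r.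
have zE : x * beta = kappa * beta `^ q.
  rewrite /x powRM ?invr_ge0 ?(ltW b0) ?(ltW Cs0)// powRV ?(ltW Cs0)// -powRN.
  rewrite mulrAC mulrC; congr (_ * _).
  by rewrite mulrC mulr_powRB1// ltW.
apply: (@le_trans _ _ ((a * (1 - x * beta / q)) `^ (- q))); last first.
  have p0 := lt_le_trans a'0 h.
  rewrite !powRN lef_pV2 ?posrE ?powR_gt0//.
  by rewrite ge0_ler_powR ?nnegrE ?(ltW q0) ?(ltW a'0) ?(ltW p0).
have h1 : 0 < 1 - x * beta / q by rewrite subr_gt0 ltr_pdivrMr// mul1r.
rewrite [(a * _) `^ _]powRM ?(ltW a0) ?(ltW h1)//.
have -> : kappa * (beta / a) `^ q = a `^ (- q) * (x * beta).
  rewrite zE [(beta / a) `^ _]powRM ?invr_ge0 ?(ltW a0) ?(ltW b0)// powRV ?(ltW a0)// -powRN.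
  by rewrite mulrA mulrC.
rewrite -{1}[a `^ _]mulr1 -mulrDr ler_pM2l ?powR_gt0//.
exact: bernoulli_inv.
Qed.

(** The arithmetic-geometric mean inequality applied to the [b i ^ q], solved
    for [a]. *)
Lemma rate_of_sum n (a : R) (b : 'I_n.+1 -> R) : 1 < s -> 0 < C -> 0 < a -> (forall i, 0 < b i) ->
  kappa * (\sum_i b i `^ q) <= a `^ (- q) ->
  a <= (2 * C * s) `^ s^-1 * n.+1%:R `^ (s^-1 - 1) *
       (\prod_i b i) `^ (- n.+1%:R^-1).
Proof.
move=> s1 C0 a0 b0 h; have q1 := conjugate_gt1 s1.
have s0 : 0 < s by lra. have sm0 : 0 < s - 1 by lra.
have Cs0 : 0 < 2 * C * s by rewrite !mulr_gt0.
have q0 : 0 < q by lra.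
set P := \prod_i b i; have P0 : 0 < P by apply: prodr_gt0 => i _.
set N := n.+1%:R : R; have N0 : 0 < N by rewrite ltr0n.
have agm : N * P `^ (q / N) <= \sum_i b i `^ q.
  have := @leif_AGM R 'I_n.+1 predT (fun i => b i `^ q) (fun i _ => powR_ge0 _ _).
  rewrite card_ord => -[+ _].
  under eq_bigl do rewrite inE.
  under [X in _ <= (X / _) ^+ _ -> _]eq_bigl do rewrite inE.
  rewrite powR_prod => [|i]; last exact: ltW.
  rewrite -/P -/N.
  set S := \sum_i _; have S0 : 0 <= S by apply: sumr_ge0 => i _; exact: powR_ge0.
  have SN0 : 0 <= S / N by rewrite divr_ge0 ?(ltW N0).
  move=> PS; rewrite mulrC -ler_pdivlMr// powRrM.
  have -> : S / N = ((S / N) ^+ n.+1) `^ N^-1.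
    by rewrite -powR_mulrn// -powRrM mulfV ?gt_eqF// powRr1.
  by rewrite ge0_ler_powR ?nnegrE ?invr_ge0 ?(ltW N0) ?powR_ge0 ?exprn_ge0.
have k0 : 0 < kappa by rewrite powR_gt0.
apply: (powRN_le _ _ q q0 a0); first by rewrite !mulr_gt0 ?powR_gt0.
apply: le_trans h; apply: le_trans (ler_wpM2l (ltW k0) agm).
rewrite le_eqVlt; apply/orP; left; apply/eqP.
rewrite powRM ?mulr_ge0 ?powR_ge0// powRM ?powR_ge0// -!powRrM mulrA.
congr (_ * _ * _).
- by congr (_ `^ _);  field; rewrite !gt_eqF.
- by rewrite -[RHS]powRr1 ?ltW//; congr (_ `^ _);  field; rewrite !gt_eqF.
- by congr (_ `^ _); rewrite mulrNN mulrC.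
Qed.
End exponents.

(** This amounts to [s^(1/s) <= sqrt 2], that is [ln s / s <= ln 2 / 2].  The
    tangent line of [ln] at [2] and [ln 2 <= 1] suffice; there is equality at
    [s = 2]. *)
Lemma smoothness_constant (s C : R) : 1 < s <= 2 -> 0 < C ->
  (2 * C * s) `^ s^-1 * Num.sqrt 2 <= 2 `^ (1 + s^-1) * C `^ s^-1.
Proof.
move=> /andP[s1 s2] C0; have s0 : 0 < s by lra.
have two : s `^ s^-1 * Num.sqrt 2 <= 2.
  rewrite -ler_ln ?posrE ?mulr_gt0 ?powR_gt0 ?sqrtr_gt0//.
  rewrite lnM ?posrE ?powR_gt0 ?sqrtr_gt0// -powR12_sqrt// !ln_powR.
  suff : s^-1 * ln s <= 2^-1 * ln 2 by move: (ln 2) => l2; lra.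
  rewrite mulrC ler_pdivrMr//.
  have h1 : ln s - ln 2 <= s / 2 - 1.
    rewrite -ln_div ?posrE// (_ : s / 2 = 1 + (s / 2 - 1)); last by ring.
    by rewrite [X in _ <= X]addrC addKr; apply: le_ln1Dx; lra.
  have h2 : ln 2 <= 1 :> R.
    have -> : (2 : R) = 1 + 1 by ring.
    by apply: le_ln1Dx; lra.
  nra.
rewrite !powRM ?mulr_ge0 ?(ltW C0) ?(ltW s0)// powRD ?pnatr_eq0 ?implybT// powRr1//.
have t0 : 0 <= 2 `^ s^-1 * C `^ s^-1 by rewrite mulr_ge0 ?powR_ge0.
rewrite -[leLHS]mulrA -[leRHS]mulrA [leRHS]mulrC.
exact: ler_wpM2l.
Qed.
End rate.

(** * Peak functionals in smooth spaces *)

Section peak.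
Context {R : realType} {X : normedModType R}.

Lemma peak_le_norm (r x : X) (F : {linear X -> R^o}) :
  peak_functional r F -> `|F x| <= `|x|.
Proof.
case=> _ F1 _; have [->|x0] := eqVneq x 0; first by rewrite linear0 !normr0.
have nx : 0 < `|x| by rewrite normr_gt0.
have : (`|F (`|x|^-1 *: x)|%:E <= dual_norm F)%E.
  apply: ereal_sup_ubound; exists (`|x|^-1 *: x) => //=.
  by rewrite normrZ normfV normr_id mulVf// gt_eqF.
rewrite F1 lee_fin linearZ/= normrM normfV normr_id.
by rewrite mulrC ler_pdivrMr// mul1r.
Qed.

Context (s C : R) (s1 : 1 < s) (C0 : 0 < C)
  (smooth : forall t : R, 0 < t ->
     (modulus_of_smoothness X t <= (C * t `^ s)%:E)%E).

(** The modulus of smoothness at [|w| / |r|], scaled by [|r|]. *)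
Lemma smooth_parallelogram (r w : X) : r != 0 ->
  `|r + w| + `|r - w| <= 2 * `|r| + 2 * C * `|r| * (`|w| / `|r|) `^ s.
Proof.
move=> r0; have nr : 0 < `|r| by rewrite normr_gt0.
have [->|w0] := eqVneq w 0.
  rewrite addr0 subr0 normr0 mul0r powR0 ?mulr0 ?addr0; first lra.
  by rewrite gt_eqF// (lt_trans _ s1).
have nw : 0 < `|w| by rewrite normr_gt0.
have t0 : 0 < `|w| / `|r| by rewrite divr_gt0.
have := smooth _ t0; set t := `|w| / `|r| => ht.
pose x := `|r|^-1 *: r; pose y := `|r|^-1 *: w.
have : ((2^-1 * `|x + y| + 2^-1 * `|x - y| - 1)%:E <= (C * t `^ s)%:E)%E.
  apply: le_trans ht; apply: ereal_sup_ubound; exists x, y; split => //.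
    by rewrite normrZ normfV normr_id mulVf// gt_eqF.
  by rewrite normrZ normfV normr_id mulrC.
have -> : x + y = `|r|^-1 *: (r + w) by rewrite scalerDr.
have -> : x - y = `|r|^-1 *: (r - w) by rewrite scalerBr.
rewrite lee_fin !normrZ normfV normr_id.
set a := `|r + w|; set b := `|r - w| => h.
have -> : a + b = `|r| * (`|r|^-1 * a + `|r|^-1 * b).
  by field; rewrite gt_eqF.
have -> : 2 * `|r| + 2 * C * `|r| * t `^ s = `|r| * (2 + 2 * (C * t `^ s)) by ring.
by rewrite ler_pM2l//; lra.
Qed.

(** The functional bounds [|r + w|] below by [|r| + F w], and smoothness bounds
    [|r + w| + |r - w|] above. *)
Lemma peak_descent (r w : X) (F : {linear X -> R^o}) :
  peak_functional r F -> r != 0 ->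
  `|r - w| + F w <= `|r| + 2 * C * `|r| * (`|w| / `|r|) `^ s.
Proof.
move=> pF r0; have := smooth_parallelogram r w r0.
have := peak_le_norm r (r + w) F pF; case: pF => _ _ Fr.
rewrite linearD Fr => /(le_trans (ler_norm _)).
have -> : (`|r| : R^o) + F w = `|r| + F w by [].
move: `|r - w| (F w : R) => b c; lra.
Qed.

(** Birkhoff orthogonality of [r] to [h] passes to the peak functional: by
    [peak_descent] the value [F h] is at most of order [l ^ (s - 1)] for every
    [l > 0], which tends to [0] because [s > 1]. *)
Lemma peak_orthogonal (r h : X) (F : {linear X -> R^o}) :
  peak_functional r F -> r != 0 ->
  (forall l : R, `|r| <= `|r - l *: h|) -> F h = 0.
Proof.
move=> pF r0.
suff main (g : X) : (forall l : R, `|r| <= `|r - l *: g|) -> F g <= 0.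
  move=> H; have h1 := main h H.
  have : F (- h) <= 0 by apply: main => l; rewrite scalerN -scaleNr; exact: H.
  by rewrite linearN oppr_le0 => h2; apply/eqP; rewrite eq_le h1.
move=> H; rewrite leNgt; apply/negP => Fg.
set B := 2 * C * `|r| * (`|g| / `|r|) `^ s.
have B0 : 0 <= B by rewrite !mulr_ge0 ?powR_ge0// ltW.
have key l : 0 < l -> F g <= B * l `^ (s - 1).
  move=> l0; rewrite -(ler_pM2l l0).
  have := H l; have := peak_descent r (l *: g) F pF r0.
  have -> : F (l *: g) = l * F g by rewrite linearZ.
  rewrite normrZ gtr0_norm// -[l * `|g| / _]mulrA powRM ?divr_ge0 ?(ltW l0)//.
  have -> : l * (B * l `^ (s - 1)) = B * l `^ s.
    by rewrite mulrCA mulr_powRB1 ?(ltW l0)// (lt_trans _ s1).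
  rewrite /B; move: (l `^ s) ((_ / _) `^ s) (l * F g : R) => p1 p2 c.
  by move: `|r - _| => d; lra.
have s1' : 0 < s - 1 by rewrite subr_gt0.
(* At this [l] the bound [B * l ^ (s - 1)] is below [F g / 2]; adding [1] to
   [B] avoids dividing by zero. *)
pose l := ((F g : R) / (2 * (B + 1))) `^ (s - 1)^-1.
have B1 : 0 < 2 * (B + 1) by lra.
have l0 : 0 < l by rewrite powR_gt0// divr_gt0.
have := key l l0; rewrite /l -powRrM mulVf ?gt_eqF// powRr1 ?divr_ge0 ?(ltW Fg) ?(ltW B1)//.
rewrite leNgt => /negP; apply.
rewrite mulrA ltr_pdivrMr// mulrC ltr_pM2l//; lra.
Qed.

End peak.

(** * Spans of selected elements and representations over the dictionary *)

Section span.
Context {R : realType} {X : normedModType R}.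
Implicit Type g : nat -> X.

Lemma span_upto_lin g n (a : R) x y :
  span_upto g n x -> span_upto g n y -> span_upto g n (a *: x + y).
Proof.
move=> [c ->] [d ->]; exists (fun i => a * c i + d i).
rewrite scaler_sumr -big_split/=; apply: eq_bigr => i _.
by rewrite scalerDl scalerA.
Qed.

Lemma span_upto0 g n : span_upto g n 0.
Proof. by exists (fun=> 0); rewrite big1// => i _; rewrite scale0r. Qed.

Lemma span_uptoZ g n (a : R) x : span_upto g n x -> span_upto g n (a *: x).
Proof. by move=> gx; rewrite -[_ *: _]addr0; apply: span_upto_lin => //; exact: span_upto0. Qed.

Lemma span_uptoD g n x y :
  span_upto g n x -> span_upto g n y -> span_upto g n (x + y).
Proof. by move=> gx gy; rewrite -[x]scale1r; exact: span_upto_lin. Qed.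

Lemma span_upto_gen g n k : (1 <= k <= n)%N -> span_upto g n (g k).
Proof.
move=> /andP[k1 kn]; exists (fun i => (i == k)%:R).
rewrite (bigD1_seq k) ?iota_uniq ?mem_index_iota ?k1 ?ltnS//= eqxx scale1r.
by rewrite big1 ?addr0// => i /negbTE ->; rewrite scale0r.
Qed.

Lemma span_uptoS g n x : span_upto g n x -> span_upto g n.+1 x.
Proof.
move=> [c ->]; exists (fun i => if (i <= n)%N then c i else 0).
rewrite [RHS]big_nat_recr//= ltnn scale0r addr0.
by apply: eq_big_nat => i /andP[_]; rewrite ltnS => ->.
Qed.

(** In a nontrivial relation the last vector with a nonzero coefficient would
    lie in the span of the previous ones. *)
Lemma greedy_free g n : (forall k, (k < n)%N -> ~ span_upto g k (g k.+1)) ->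
  forall c : 'I_n -> R, \sum_(i < n) c i *: g i.+1 = 0 -> forall i, c i = 0.
Proof.
elim: n => [_ c _ []//|n IH] ind c; rewrite big_ord_recr/= => sum0.
have cn : c ord_max = 0.
  apply/eqP; apply: contrapT => /negP cn0; apply: (ind n (ltnSn n)).
  have -> : g n.+1 = (- (c ord_max)^-1) *:
      \sum_(i < n) c (widen_ord (leqnSn n) i) *: g i.+1.
    move/eqP: sum0; rewrite addr_eq0 => /eqP ->.
    by rewrite scaleNr scalerN opprK scalerA mulVf// scale1r.
  apply: span_uptoZ.
  elim/big_ind : _ => [||i _]; [exact: span_upto0|exact: span_uptoD|].
  by apply: span_uptoZ; apply: span_upto_gen; rewrite ltn_ord.
move: sum0; rewrite cn scale0r addr0 => sum0 i.
have [iltn|] := ltnP i n; last first.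
  by move=> ni; rewrite (_ : i = ord_max)//; apply/val_inj/eqP; rewrite eqn_leq -ltnS ltn_ord ni.
have := IH _ (fun i => c (widen_ord (leqnSn n) i)) sum0 (Ordinal iltn).
rewrite (_ : widen_ord _ _ = i); first by apply => k kn; apply: ind; exact: ltnW.
exact: val_inj.
Qed.

(** Evaluating [F] on a representation of [f]; continuity of [F] is used for
    the countable ones.  The case [M = 0] is separate since it needs one
    representation of finite cost, whereas for [M > 0] dividing by [M] bounds
    the infimum directly. *)
Lemma L1_norm_functional (K : set X) (f : X) (F : {linear X -> R^o}) (M : R) :
  (L1_norm K f < +oo)%E -> continuous F -> 0 <= M -> (forall h, K h -> `|F h| <= M) ->
  `|F f| <= M * fine (L1_norm K f).
Proof.
rewrite /L1_norm; set E := (X in ereal_inf X) => Loo cF M0 FK.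
have rep z : E z -> (0 <= z)%E /\ (z != +oo -> `|F f|%:E <= M%:E * z)%E.
  case=> [[m [c [h [hK fE ->]]]]|[c [h [hK fE ->]]]].
    split=> [|_]; first by rewrite lee_fin sumr_ge0.
    rewrite -EFinM lee_fin fE linear_sum mulr_sumr.
    apply: le_trans (ler_norm_sum _ _ _) _; apply: ler_sum => i _.
    by rewrite linearZ/= normrM mulrC ler_wpM2r// FK.
  have c0 i : (0 <= `|c i|%:E :> \bar R)%E by rewrite lee_fin.
  have z0 : (0 <= \sum_(0 <= i <oo) `|c i|%:E)%E by exact: nneseries_ge0.
  split=> // zoo.
  have zfin : (\sum_(0 <= i <oo) `|c i|%:E)%E \is a fin_num.
    by rewrite ge0_fin_numE// ltey.
  have part n : \sum_(0 <= i < n) `|c i| <= fine (\sum_(0 <= i <oo) `|c i|%:E)%E.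
    rewrite -lee_fin fineK// -sumEFin.
    exact: (@nneseries_lim_ge _ (fun i => `|c i|%:E) xpredT 0 n).
  rewrite -(fineK zfin) -EFinM lee_fin.
  have cvF : `|F (series (fun i => c i *: h i) n)| @[n --> \oo] --> `|F f|.
    by apply: cvg_norm; apply: cvg_comp fE _; exact: cF.
  rewrite -(cvg_lim _ cvF)//; apply: limr_le; first by apply/cvg_ex; eexists; exact: cvF.
  apply: nearW => n; rewrite /series/= linear_sum.
  apply: le_trans (ler_norm_sum _ _ _) _.
  apply: le_trans (ler_wpM2l M0 (part n)); rewrite mulr_sumr.
  by apply: ler_sum => i _; rewrite linearZ/= normrM mulrC ler_wpM2r// FK.
have L0 : (0 <= ereal_inf E)%E by apply/ereal_infP => z /rep[].
have Lfin : ereal_inf E \is a fin_num by rewrite ge0_fin_numE.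
move: M0; rewrite le_eqVlt => /predU1P[M0|M0].
  have [z Ez zoo] := ereal_inf_lt Loo.
  have [_ /(_ (negbT (lt_eqF zoo)))] := rep z Ez.
  by rewrite -M0 mul0e lee_fin mul0r.
rewrite mulrC -ler_pdivrMr// -lee_fin fineK//; apply/ereal_infP => z /rep[].
case: z => [r|_ _|]; [move=> _ /(_ isT)|by rewrite leey|by []].
by rewrite -EFinM !lee_fin ler_pdivrMr// mulrC.
Qed.
End span.

(** * The recursion satisfied by the residuals *)

Section greedy.
Context {R : realType} {X : normedModType R} (s C : R).
Hypotheses (s1 : 1 < s) (C0 : 0 < C).
Hypothesis smooth : forall t : R, 0 < t ->
  (modulus_of_smoothness X t <= (C * t `^ s)%:E)%E.
Context (K : set X) (f : X) (N : nat) (alpha : nat -> R).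
Hypothesis L1_fin : (L1_norm K f < +oo)%E.
Hypothesis alpha_gt0 : forall n, (1 <= n)%N -> 0 < alpha n.
Context (F : nat -> {linear X -> R^o}) (g fn : nat -> X).
Hypothesis run : WCGA_run K f N alpha F g fn.
Notation L := (fine (L1_norm K f)).
Notation q := (s / (s - 1)).
Notation kappa := ((2 * C * s) `^ (- (q - 1))).

Lemma greedy_span k : (k <= N)%N -> span_upto g k (fn k).
Proof.
case: k => [_|k kN]; last exact: wcga_span run k kN.
by rewrite (wcga_init run); exact: span_upto0.
Qed.

Lemma greedy_best k h : (k <= N)%N -> span_upto g k h -> `|f - fn k| <= `|f - h|.
Proof.
case: k => [_ [c ->]|k kN gh].
  by rewrite (wcga_init run) big_geq.
rewrite -lee_fin (wcga_best run kN); apply: ereal_inf_lbound; by exists h.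
Qed.

Lemma greedy_mono k : (k < N)%N -> `|f - fn k.+1| <= `|f - fn k|.
Proof. by move=> kN; apply: greedy_best => //; exact/span_uptoS/greedy_span/ltnW. Qed.

Lemma greedy_residual_gt0 n : (n <= N)%N -> 0 < `|f - fn n| ->
  forall k, (k <= n)%N -> 0 < `|f - fn k|.
Proof.
move=> nN fn0 k /subnK.
move: (n - k)%N => m; elim: m k => [|m IH] k kn.
  by rewrite -[k]add0n kn.
apply: (@lt_le_trans _ _ `|f - fn k.+1|); first by apply: IH; rewrite addnS -addSn.
by apply: greedy_mono; rewrite (leq_trans _ nN)// -kn addSn ltnS leq_addl.
Qed.

Lemma greedy_orthogonal k h : (k < N)%N -> f - fn k != 0 ->
  span_upto g k h -> F k h = 0.
Proof.
move=> kN r0 gh; have pF := wcga_peak run kN.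
apply: (peak_orthogonal s C s1 C0 smooth _ _ _ pF r0) => l.
rewrite -addrA -opprD; apply: greedy_best (ltnW kN) _.
by apply: span_uptoD; [exact/greedy_span/ltnW|exact: span_uptoZ].
Qed.

(** The left factor is [F k f], because [F k] vanishes on [fn k]; by the
    selection rule, [|F k|] is bounded on [K] by
    [|F k (g k.+1)| / alpha k.+1]. *)
Lemma greedy_select k : (k < N)%N -> f - fn k != 0 ->
  alpha k.+1 * `|f - fn k| <= L * `|F k (g k.+1)|.
Proof.
move=> kN r0; have [cF _ Fr] := wcga_peak run kN.
have a0 := alpha_gt0 k.+1 isT.
have Ff : F k f = `|f - fn k|.
  rewrite -Fr linearB/= (greedy_orthogonal _ (fn k))//; first by rewrite subr0.
  exact/greedy_span/ltnW.
have M0 : 0 <= `|F k (g k.+1)| / alpha k.+1 by rewrite divr_ge0// ltW.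
have FK h : K h -> `|F k h| <= `|F k (g k.+1)| / alpha k.+1.
  move=> Kh; rewrite ler_pdivlMr// mulrC -lee_fin EFinM.
  apply: le_trans (wcga_select run kN).
  by rewrite lee_pmul2l//; apply: ereal_sup_ubound; exists h.
have := L1_norm_functional K f (F k) _ L1_fin cF M0 FK.
by rewrite Ff normr_id mulrAC ler_pdivlMr// mulrC (mulrC L).
Qed.

(** Otherwise [F k] would vanish at [g k.+1], hence on all of [K] and
    at [f]. *)
Lemma greedy_new k : (k < N)%N -> f - fn k != 0 -> ~ span_upto g k (g k.+1).
Proof.
move=> kN r0 gk; have := greedy_select _ kN r0.
rewrite greedy_orthogonal// normr0 mulr0 leNgt mulr_gt0//; first exact: alpha_gt0.
by rewrite normr_gt0.
Qed.

Lemma L1_norm_gt0 k : (k < N)%N -> f - fn k != 0 -> 0 < L.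
Proof.
move=> kN r0; have := greedy_select _ kN r0.
have lhs : 0 < alpha k.+1 * `|f - fn k|.
  by rewrite mulr_gt0 ?alpha_gt0// normr_gt0.
move/(lt_le_trans lhs) => rhs; rewrite ltNge; apply/negP => L0.
by move: rhs; rewrite ltNge mulr_le0_ge0.
Qed.

(** The next residual is at most [|r - v|] for every multiple [v] of
    [w = g k.+1 - h], and [F k w = F k (g k.+1)] because [F k] vanishes at
    [h].  Allowing an arbitrary [h] leaves its choice to the isomorphism with
    Euclidean space. *)
Lemma greedy_step k (h : X) (omega : R) : (k < N)%N ->
  0 < `|f - fn k.+1| -> span_upto g k h -> 0 < omega -> `|g k.+1 - h| <= omega ->
  `|f - fn k| `^ (- q) + kappa * (alpha k.+1 / (L * omega)) `^ q
    <= `|f - fn k.+1| `^ (- q).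
Proof.
move=> kN r1 gh w0 gw.
have r0 := lt_le_trans r1 (greedy_mono k kN).
have rn0 : f - fn k != 0 by rewrite -normr_gt0.
have L0 := L1_norm_gt0 k kN rn0.
have a0 := alpha_gt0 k.+1 isT.
pose beta := alpha k.+1 * `|f - fn k| / (L * omega).
have b0 : 0 < beta by rewrite divr_gt0 ?mulr_gt0.
have -> : alpha k.+1 / (L * omega) = beta / `|f - fn k|.
  by rewrite /beta; field; rewrite !gt_eqF.
apply: rate_step => // x x0.
have pF := wcga_peak run kN.
(* The length [l] makes [|l w| / |r| <= x], and the sign of [F k w] makes the
   functional increase along [v]. *)
pose w := g k.+1 - h; pose l := x * `|f - fn k| / omega.
have l0 : 0 < l by rewrite divr_gt0 ?mulr_gt0.
have Fw : F k w = F k (g k.+1).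
  by rewrite linearB/= (greedy_orthogonal _ h)// subr0.
pose v := (l * Num.sg (F k w : R)) *: w.
have Fv : F k v = l * `|F k w : R|.
  have -> : F k v = l * Num.sg (F k w : R) * F k w by rewrite linearZ.
  by rewrite -mulrA -normrEsg.
have vnorm : `|v| / `|f - fn k| <= x.
  rewrite ler_pdivrMr// normrZ normrM (gtr0_norm l0).
  apply: (@le_trans _ _ (l * omega)); last by rewrite divfK// gt_eqF.
  rewrite -mulrA ler_pM2l//; apply: le_trans gw.
  rewrite -[leRHS]mul1r ler_wpM2r// normr_sg; by case: (_ != 0).
have best : `|f - fn k.+1| <= `|f - fn k - v|.
  rewrite -addrA -opprD; apply: greedy_best => //; apply: span_uptoD.
    exact/span_uptoS/greedy_span/ltnW.
  apply: span_uptoZ; rewrite /w -scaleN1r addrC.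
  apply: span_upto_lin; first exact: span_uptoS.
  by apply: span_upto_gen; rewrite leqnn.
have desc := peak_descent s C s1 smooth _ v _ pF rn0.
have gain : x * `|f - fn k| * beta <= F k v.
  rewrite Fv Fw.
  have -> : x * `|f - fn k| * beta = l * (alpha k.+1 * `|f - fn k| / L).
    by rewrite /beta /l; field; rewrite !gt_eqF.
  by rewrite ler_pM2l// ler_pdivrMr// [leRHS]mulrC; exact: greedy_select.
have pw : 2 * C * `|f - fn k| * (`|v| / `|f - fn k|) `^ s <=
    2 * C * `|f - fn k| * x `^ s.
  rewrite ler_wpM2l//; first by rewrite !mulr_ge0// ltW.
  rewrite ge0_ler_powR ?nnegrE ?divr_ge0 ?(ltW x0)//.
  by rewrite ltW// (lt_trans _ s1).
move: desc gain best pw; move: (F k v : R) => c; lra.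
Qed.

End greedy.

(** * Isomorphisms onto Euclidean space *)

Section l2.
Context {R : realType}.

Lemma l2_normE n (u : 'rV[R]_n) : l2_norm u = Num.sqrt (sqnorm u).
Proof. by rewrite /l2_norm sqnormE. Qed.

Lemma l2_norm_ge0 n (u : 'rV[R]_n) : 0 <= l2_norm u.
Proof. exact: sqrtr_ge0. Qed.

Lemma sqr_l2_norm n (u : 'rV[R]_n) : l2_norm u ^+ 2 = sqnorm u.
Proof. by rewrite l2_normE sqr_sqrtr// sqnorm_ge0. Qed.

Lemma l2_norm_eq0 n (u : 'rV[R]_n) : (l2_norm u == 0) = (u == 0).
Proof. by rewrite -sqrf_eq0 sqr_l2_norm sqnorm_eq0. Qed.

Lemma l2_normZ n a (u : 'rV[R]_n) : l2_norm (a *: u) = `|a| * l2_norm u.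
Proof.
rewrite !l2_normE -sqrtr_sqr -sqrtrM ?sqr_ge0//; congr Num.sqrt.
by rewrite !sqnormE mulr_sumr; apply: eq_bigr => i _; rewrite mxE exprMn.
Qed.

End l2.

Section linear_iso.
Context {R : realType} {X : normedModType R} (n : nat).
Context (Y : set X) (T : X -> 'rV[R]_n) (S : 'rV[R]_n -> X).
Hypotheses (Y0 : Y 0)
  (Ylin : forall (a : R) x y, Y x -> Y y -> Y (a *: x + y))
  (iso : linear_iso Y T S).

Lemma linear_iso0 : T 0 = 0.
Proof.
have [Tlin _ _ _] := iso; have := Tlin 1 0 0 Y0 Y0.
by rewrite !scale1r addr0 => /(congr1 (fun u => u - T 0)); rewrite addrK subrr.
Qed.

Lemma linear_isoZ a x : Y x -> T (a *: x) = a *: T x.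
Proof.
by have [Tlin _ _ _] := iso => Yx; rewrite -[_ *: x]addr0 Tlin// linear_iso0 addr0.
Qed.

Lemma linear_isoB x y : Y x -> Y y -> T (x - y) = T x - T y.
Proof.
have [Tlin _ _ _] := iso => Yx Yy.
by rewrite addrC -scaleN1r Tlin// scaleN1r addrC.
Qed.

Lemma linear_iso_sum m (b : 'I_m -> X) (c : 'I_m -> R) : (forall i, Y (b i)) ->
  Y (\sum_i c i *: b i) /\ T (\sum_i c i *: b i) = \sum_i c i *: T (b i).
Proof.
move=> Yb; have [Tlin _ _ _] := iso.
elim/big_rec2 : _ => [|i u x _ [Yx Tx]]; first by split; rewrite ?linear_iso0.
by split; [exact: Ylin|rewrite Tlin// Tx].
Qed.

Lemma linear_iso_invZ a u : S (a *: u) = a *: S u.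
Proof.
have [_ ST YS TS] := iso.
rewrite -[in LHS](TS u) -linear_isoZ ?ST//.
by rewrite -[_ *: _]addr0; exact: Ylin.
Qed.

Lemma norm_to_l2_bound t y : norm_to_l2 Y T = t%:E -> Y y -> l2_norm (T y) <= t * `|y|.
Proof.
move=> tE Yy; have [->|y0] := eqVneq y 0.
  by rewrite linear_iso0 normr0 mulr0 l2_normE sqnormE big1 ?sqrtr0// => i _;
    rewrite mxE expr0n.
have ny : 0 < `|y| by rewrite normr_gt0.
have Yz : Y (`|y|^-1 *: y) by rewrite -[_ *: _]addr0; exact: Ylin.
have : ((l2_norm (T (`|y|^-1 *: y)))%:E <= norm_to_l2 Y T)%E.
  apply: ereal_sup_ubound; exists (`|y|^-1 *: y) => //; split => //.
  by rewrite normrZ normfV normr_id mulVf// gt_eqF.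
rewrite tE lee_fin linear_isoZ// l2_normZ normfV normr_id.
by rewrite mulrC ler_pdivrMr.
Qed.

Lemma norm_from_l2_bound t u : norm_from_l2 S = t%:E -> `|S u| <= t * l2_norm u.
Proof.
move=> tE; have [->|u0] := eqVneq u 0.
  rewrite -{1}(scale0r 0) linear_iso_invZ scale0r normr0 l2_normE sqnormE.
  by rewrite big1 ?sqrtr0 ?mulr0// => i _; rewrite mxE expr0n.
have nu : 0 < l2_norm u by rewrite lt0r l2_norm_eq0 u0 l2_norm_ge0.
have : (`|S ((l2_norm u)^-1 *: u)|%:E <= norm_from_l2 S)%E.
  apply: ereal_sup_ubound; exists ((l2_norm u)^-1 *: u) => //=.
  by rewrite l2_normZ normfV gtr0_norm// mulVf// gt_eqF.
rewrite tE lee_fin linear_iso_invZ normrZ normfV gtr0_norm//.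
by rewrite mulrC ler_pdivrMr.
Qed.

Lemma norm_from_l2_gt0 : (0 < n)%N -> (0 < norm_from_l2 S)%E.
Proof.
move=> n0; pose u : 'rV[R]_n := delta_mx 0 (Ordinal n0).
have u1 : l2_norm u = 1.
  rewrite l2_normE sqnormE (bigD1 (Ordinal n0))//= big1 ?addr0.
    by rewrite mxE !eqxx expr1n sqrtr1.
  by move=> i /negbTE i0; rewrite mxE i0 andbF expr0n.
apply: (@lt_le_trans _ _ `|S u|%:E); last first.
  by apply: ereal_sup_ubound; exists u => //=; rewrite u1.
have [_ _ _ TS] := iso.
rewrite lte_fin normr_gt0; apply/eqP => Su.
have : l2_norm u == 0 by rewrite l2_norm_eq0 -(TS u) Su linear_iso0.
by rewrite u1 oner_eq0.
Qed.

Lemma norm_to_l2_gt0 : (0 < n)%N -> (0 < norm_to_l2 Y T)%E.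
Proof.
move=> n0; have Sgt0 := norm_from_l2_gt0 n0.
have [_ _ YS TS] := iso.
have Tge0 : (0 <= norm_to_l2 Y T)%E.
  apply: ereal_sup_ubound; exists 0; first by rewrite /= normr0.
  by rewrite linear_iso0 l2_normE sqnormE big1 ?sqrtr0// => i _; rewrite mxE expr0n.
rewrite lt0e Tge0 andbT; apply/eqP => T0.
move: Sgt0; rewrite ltNge => /negP; apply.
apply: ge_ereal_sup => _ [u _ <-].
have := norm_to_l2_bound 0 (S u) T0 (YS u).
rewrite TS mul0r => u0; have {}u0 : u = 0.
  by apply/eqP; rewrite -l2_norm_eq0 eq_le u0 l2_norm_ge0.
by rewrite u0 -{1}(scale0r 0) linear_iso_invZ scale0r normr0.
Qed.

(** Lower bounds for the distance to Euclidean space only need to be checked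
    when both norms are finite: in positive dimension neither norm is [0], so
    an infinite factor makes the product infinite. *)
Lemma norm_product_ge (P : R) : (0 < n)%N ->
  (forall t u : R, 0 < t -> 0 < u -> norm_to_l2 Y T = t%:E ->
     norm_from_l2 S = u%:E -> P <= t * u) ->
  (P%:E <= norm_to_l2 Y T * norm_from_l2 S)%E.
Proof.
move=> n0; have := norm_to_l2_gt0 n0; have := norm_from_l2_gt0 n0.
case: (norm_to_l2 Y T) => [t| |//]; case: (norm_from_l2 S) => [u| |//] u0 t0 H.
- by rewrite -EFinM lee_fin; exact: H.
- by rewrite gt0_muley// leey.
- by rewrite gt0_mulye// leey.
- by rewrite mulyy leey.
Qed.

End linear_iso.

(** * Coverings of the symmetric convex hull *)

Section hull_covering.
Context {R : realType} {X : normedModType R}.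

Lemma hull_comb (K : set X) m (b : 'I_m -> X) (y : 'I_m -> R) :
  (forall i, K (b i)) -> \sum_i `|y i| <= 1 ->
  sym_convex_hull K (\sum_i y i *: b i).
Proof. by move=> Kb y1; apply: subset_closure; exists m, y, b. Qed.

Context (n : nat) (Y : set X) (T : X -> 'rV[R]_n.+1) (S : 'rV[R]_n.+1 -> X).
Hypotheses (Y0 : Y 0)
  (Ylin : forall (a : R) x y, Y x -> Y y -> Y (a *: x + y))
  (iso : linear_iso Y T S).
Context (K : set X) (b : 'I_n.+1 -> X).
Hypotheses (Kb : forall i, K (b i)) (Yb : forall i, Y (b i)).
Context (e t : R) (c : 'I_(2 ^ n.+1) -> X).
Hypotheses (e0 : 0 < e) (t0 : 0 < t)
  (cover : sym_convex_hull K `<=` \bigcup_i ball (c i) e)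
  (Tt : norm_to_l2 Y T = t%:E).

(** Each ball meets [Y] in a set whose image under [T] has diameter at most
    [2 t e]; [jung] encloses it in a Euclidean ball, and these balls cover the
    cross-polytope spanned by the [T (b i)]. *)
Lemma hull_covering_det eta : 0 < eta ->
  `|\det (\matrix_i T (b i))| <=
  n.+1`!%:R * unit_ball_volume R n.+1 * hpow n.+1 (2 * (t * e) ^+ 2 + eta).
Proof.
move=> eta0; set U := \matrix_i T (b i).
have centre j : exists z, forall y, Y y -> ball (c j) e y ->
    sqnorm (T y - z) < 2 * (t * e) ^+ 2 + eta.
  have [|z zP] := @jung R n.+1 [set T y | y in [set y | Y y /\ ball (c j) e y]]
    (4 * (t * e) ^+ 2) eta eta0.
    move=> _ _ [x [Yx xj] <-] [y [Yy yj] <-].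
    rewrite -(linear_isoB _ _ _ _ iso)// -sqr_l2_norm.
    have Yxy : Y (x - y) by rewrite addrC -scaleN1r; exact: Ylin.
    have -> : 4 * (t * e) ^+ 2 = (t * (2 * e)) ^+ 2 by ring.
    rewrite ler_sqr ?nnegrE ?l2_norm_ge0//; last by rewrite !mulr_ge0// ltW.
    apply: le_trans (norm_to_l2_bound _ _ _ _ Y0 Ylin iso _ _ Tt Yxy) _.
    rewrite ler_pM2l//.
    have -> : x - y = (x - c j) + (c j - y) by rewrite addrA subrK.
    apply: le_trans (ler_normD _ _) _.
    move: xj yj; rewrite -!ball_normE/= distrC => xj yj.
    by rewrite mulr_natl mulr2n lerD// ltW.
  exists z => y Yy yj.
  have -> : 2 * (t * e) ^+ 2 = 4 * (t * e) ^+ 2 / 2 by field.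
  by apply: zP; exists y.
have [z zP] := choice centre.
have := @det_covering R n (2 ^ n.+1) U z (2 * (t * e) ^+ 2 + eta).
set r := _ + eta => vol.
suff : 2 ^+ n.+1 / n.+1`!%:R * `|\det U| <=
    (2 ^ n.+1)%:R * (unit_ball_volume R n.+1 * hpow n.+1 r).
  rewrite natrX -mulrA ler_pM2l ?exprn_gt0// [leLHS]mulrC.
  by rewrite ler_pdivrMr ?ltr0n ?fact_gt0// [leRHS]mulrC mulrA.
apply: vol => y y1.
have [Yy Ty] := linear_iso_sum _ _ _ _ Y0 Ylin iso _ b (fun i => y 0 i) Yb.
have [j _ jP] := cover _ (hull_comb K _ b (fun i => y 0 i) Kb (ltW y1)).
exists j; have := zP j _ Yy jP; rewrite Ty.
suff -> : y *m U = \sum_i y 0 i *: T (b i) by [].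
by rewrite mulmx_sum_row; apply: eq_bigr => i _; rewrite rowK.
Qed.

(** The limit [eta -> 0] of [hull_covering_det], after extracting a root. *)
Lemma hull_covering_volume :
  `|\det (\matrix_i T (b i))| `^ n.+1%:R^-1 <=
  (n.+1`!%:R * unit_ball_volume R n.+1) `^ n.+1%:R^-1 * (Num.sqrt 2 * (t * e)).
Proof.
set d := `|_|; set v := _ * unit_ball_volume _ _.
have v0 : 0 < v by rewrite mulr_gt0 ?unit_ball_volume_gt0// ltr0n fact_gt0.
have te0 : 0 < t * e by rewrite mulr_gt0.
have N0 : 0 < n.+1%:R :> R by rewrite ltr0n.
have x0 : 0 < 2 * (t * e) ^+ 2 by rewrite mulr_gt0// exprn_gt0.
have d0 : 0 <= d by exact: normr_ge0.
have dv0 : 0 <= d / v by rewrite divr_ge0// ltW.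
have key : (d / v) `^ (2 / n.+1%:R) <= 2 * (t * e) ^+ 2.
  apply/ler_addgt0Pr => eta eta0.
  have y0 : 0 < 2 * (t * e) ^+ 2 + eta by rewrite addr_gt0.
  have := hull_covering_det eta eta0; rewrite -/d -/v hpow_gt0// => h.
  have -> : 2 * (t * e) ^+ 2 + eta =
      (2 * (t * e) ^+ 2 + eta) `^ (n.+1%:R / 2) `^ (2 / n.+1%:R).
    have inv : n.+1%:R / 2 * (2 / n.+1%:R) = 1 :> R by field; rewrite gt_eqF.
    by rewrite -powRrM inv powRr1// ltW.
  rewrite ge0_ler_powR ?nnegrE ?powR_ge0 ?divr_ge0 ?(ltW N0) ?(ltW v0)//.
  by rewrite ler_pdivrMr// mulrC.
have sq : 0 <= Num.sqrt 2 * (t * e) by rewrite mulr_ge0 ?sqrtr_ge0// ltW.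
rewrite -[d in leLHS](divfK (lt0r_neq0 v0)) powRM ?(ltW v0)// mulrC.
rewrite ler_wpM2l ?powR_ge0//.
rewrite -ler_sqr ?nnegrE ?powR_ge0// exprMn sqr_sqrtr//.
by rewrite -powR_mulrn ?powR_ge0// -powRrM [_^-1 * _]mulrC.
Qed.

End hull_covering.

(** * The rate for a given isomorphism *)

Section orthogonalization.
Context {R : realType} {X : normedModType R}.

Definition family_span n (b : 'I_n -> X) : set X :=
  [set x | exists c : 'I_n -> R, x = \sum_(i < n) c i *: b i].
Arguments family_span {n}.

Lemma family_span_lin n (b : 'I_n -> X) (a : R) x y :
  family_span b x -> family_span b y -> family_span b (a *: x + y).
Proof.
move=> [c ->] [d ->]; exists (fun i => a * c i + d i).
rewrite scaler_sumr -big_split/=; apply: eq_bigr => i _.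
by rewrite scalerDl scalerA.
Qed.

Lemma family_span0 n (b : 'I_n -> X) : family_span b 0.
Proof. by exists (fun=> 0); rewrite big1// => i _; rewrite scale0r. Qed.

Lemma family_span_gen n (b : 'I_n -> X) i : family_span b (b i).
Proof.
exists (fun j => (j == i)%:R); rewrite (bigD1 i)//= eqxx scale1r big1 ?addr0//.
by move=> j /negbTE ->; rewrite scale0r.
Qed.

(** The Gram-Schmidt process for the vectors [T (b i)]: in coordinates where
    they form a lower triangular matrix [L], the vector [L i i] times the
    [i]-th coordinate vector differs from row [i] by a combination of the
    previous rows.  Rotated back, it is the image under [T] of
    [g i.+1 - h]. *)
Lemma orthogonalized_greedy n (g : nat -> X) (T : X -> 'rV[R]_n)
    (S : 'rV[R]_n -> X) (u : R) (b := fun i : 'I_n => g i.+1) :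
  linear_iso (family_span b) T S -> 
  (forall c : 'I_n -> R, \sum_(i < n) c i *: b i = 0 -> forall i, c i = 0) ->
  norm_from_l2 S = u%:E ->
  exists ell : 'I_n -> R, [/\ forall i, 0 < ell i,
    \prod_i ell i = `|\det (\matrix_i T (b i))| &
    forall i : 'I_n, exists2 h, span_upto g i h & `|g i.+1 - h| <= u * ell i].
Proof.
move=> iso free Su; set U := \matrix_i T (b i).
have Y0 := family_span0 _ b; have Ylin := family_span_lin _ b.
have Yb := family_span_gen _ b.
have [_ ST _ _] := iso.
have TU (y : 'rV[R]_n) : family_span b (\sum_i y 0 i *: b i) /\
    T (\sum_i y 0 i *: b i) = y *m U.
  have [Yy ->] := linear_iso_sum _ _ _ _ Y0 Ylin iso _ b (fun i => y 0 i) Yb.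
  by split=> //; rewrite mulmx_sum_row; apply: eq_bigr => i _; rewrite rowK.
have Uunit : U \in unitmx.
  rewrite -row_free_unit; apply: inj_row_free => y yU.
  have [Yy Ty] := TU y; have := ST _ Yy; rewrite Ty yU.
  have -> : S 0 = 0.
    by rewrite -[in LHS](linear_iso0 _ _ _ _ Y0 iso) ST.
  by move=> /esym/free y0; apply/rowP => i; rewrite y0 mxE.
have [Q [QQ trig diag]] := qr_decomposition _ U.
have [L LE] : exists L : 'M[R]_n, L = U *m Q by exists (U *m Q).
rewrite -LE in trig diag.
have detL : \prod_i L i i = `|\det U|.
  rewrite -[LHS]ger0_norm; last by apply: prodr_ge0 => i _.
  by rewrite -det_trig// LE det_mulmx normrM (norm_det_orthogonal _ _ QQ) mulr1.
have Lneq0 i : L i i != 0.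
  have : \det U != 0 by rewrite -unitfE -unitmxE.
  by apply: contra => /eqP Li; rewrite -normr_eq0 -detL (bigD1 i)//= Li mul0r.
exists (fun i => L i i); split=> // [i|i]; first by rewrite lt0r Lneq0 diag.
have [k ik|a ai aE] := trig_mx_span _ L trig Lneq0 i (L i i *: delta_mx 0 i - row i L).
  rewrite !mxE eqxx/=; move: ik; rewrite leq_eqVlt => /predU1P[ik|ik].
    have -> : k = i by apply/val_inj.
    by rewrite eqxx mulr1 subrr.
  rewrite (is_trig_mxP trig _ _ ik) subr0.
  suff -> : (k == i) = false by rewrite mulr0.
  by apply/negbTE; rewrite -val_eqE/= gtn_eqF.
exists (- \sum_j a 0 j *: b j).
  rewrite -scaleN1r; apply: span_uptoZ.
  elim/big_ind : _ => [||j _]; [exact: span_upto0|exact: span_uptoD|].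
  have [ij|ji] := leqP i j; first by rewrite ai// scale0r; exact: span_upto0.
  by apply: span_uptoZ; apply: span_upto_gen; rewrite ji.
have [Yy Ty] := TU (delta_mx 0 i + a).
have -> : g i.+1 - - \sum_j a 0 j *: b j = S (L i i *: delta_mx 0 i *m Q^T).
  have -> : L i i *: delta_mx 0 i *m Q^T = (delta_mx 0 i + a) *m U.
    have -> : L i i *: delta_mx 0 i = (delta_mx 0 i + a) *m L.
      by rewrite mulmxDl -aE -rowE addrC subrK.
    by rewrite LE -!mulmxA QQ mulmx1.
  rewrite -Ty ST// opprK.
  under [RHS]eq_bigr do rewrite mxE scalerDl.
  rewrite big_split/=; congr (_ + _).
  rewrite (bigD1 i)//= mxE !eqxx scale1r big1 ?addr0// => j /negbTE ji.
  by rewrite mxE ji andbF scale0r.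
apply: le_trans (norm_from_l2_bound _ _ _ _ Y0 Ylin iso _ _ Su) _.
rewrite ler_wpM2l//.
  rewrite -lee_fin -Su; apply: le_trans (_ : `|S 0|%:E <= _)%E; first by rewrite lee_fin.
  apply: ereal_sup_ubound; exists 0 => //=.
  by rewrite l2_normE sqnormE big1 ?sqrtr0// => k _; rewrite mxE expr0n.
rewrite -scalemxAl l2_normZ ger0_norm// -[leRHS]mulr1 ler_wpM2l//.
rewrite l2_normE sqnormM ?trmxK; last exact: mulmx1C.
rewrite sqnormE (bigD1 i)//= mxE !eqxx big1 ?addr0 ?expr1n ?sqrtr1// => k /negbTE ki.
by rewrite mxE ki andbF expr0n.
Qed.

End orthogonalization.
Arguments family_span {R X n}.

Section greedy_rate.
Context {R : realType} {X : normedModType R} (s C : R).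
Hypotheses (s12 : 1 < s <= 2) (C0 : 0 < C).
Hypothesis smooth : forall t : R, 0 < t ->
  (modulus_of_smoothness X t <= (C * t `^ s)%:E)%E.
Context (K : set X) (f : X) (N : nat) (alpha : nat -> R).
Hypothesis L1_fin : (L1_norm K f < +oo)%E.
Hypothesis alpha_gt0 : forall n, (1 <= n)%N -> 0 < alpha n.
Context (F : nat -> {linear X -> R^o}) (g fn : nat -> X).
Hypothesis run : WCGA_run K f N alpha F g fn.
Context (n : nat).
Hypotheses (nN : (n.+1 <= N)%N) (res_gt0 : 0 < `|f - fn n.+1|).
Notation L := (fine (L1_norm K f)).
Let b := fun i : 'I_n.+1 => g i.+1.

Let s1 : 1 < s. Proof. by case/andP: s12. Qed.

Let res_neq0 k : (k <= n)%N -> f - fn k != 0.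
Proof.
move=> kn; rewrite -normr_gt0.
by apply: (greedy_residual_gt0 _ _ _ _ _ _ _ run _ nN res_gt0); exact: ltnW.
Qed.

Lemma greedy_basis_free (c : 'I_n.+1 -> R) :
  \sum_i c i *: b i = 0 -> forall i, c i = 0.
Proof.
apply: greedy_free => k kn.
apply: (greedy_new s C s1 C0 smooth _ _ _ _ L1_fin alpha_gt0 _ _ _ run).
  exact: leq_trans nN.
exact: res_neq0.
Qed.

Lemma greedy_basis_mem i : K (b i).
Proof. by apply: (wcga_mem run); exact: leq_trans nN. Qed.

Lemma greedy_L1_gt0 : 0 < L.
Proof.
apply: (L1_norm_gt0 s C s1 C0 smooth _ _ _ _ L1_fin alpha_gt0 _ _ _ run 0).
  exact: leq_trans nN.
exact: res_neq0.
Qed.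

(** [greedy_step] with [omega_k = u * ell k], summed over [k], combined with the
    volume bound on the product of the [ell k]. *)
Lemma greedy_rate (T : X -> 'rV[R]_n.+1) (S : 'rV[R]_n.+1 -> X) (t u e : R)
    (c : 'I_(2 ^ n.+1) -> X) :
  linear_iso (family_span b) T S ->
  0 < t -> norm_to_l2 (family_span b) T = t%:E ->
  0 < u -> norm_from_l2 S = u%:E ->
  0 < e -> sym_convex_hull K `<=` \bigcup_i ball (c i) e ->
  `|f - fn n.+1| <=
    2 `^ (1 + s^-1) * C `^ s^-1 *
      (\prod_(i < n.+1) alpha i.+1) `^ (- n.+1%:R^-1) *
    (n.+1%:R `^ (s^-1 - 1) *
      (n.+1`!%:R * unit_ball_volume R n.+1) `^ n.+1%:R^-1) * L * e * (t * u).
Proof.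
move=> iso t0 tE u0 uE e0 cover.
have L0 := greedy_L1_gt0.
have [ell [ell0 ellU ellg]] := orthogonalized_greedy _ _ _ _ _ iso greedy_basis_free uE.
have vol := hull_covering_volume _ _ _ _ (family_span0 _ b) (family_span_lin _ b) iso
  _ _ greedy_basis_mem (family_span_gen _ b) _ _ _ e0 t0 cover tE.
rewrite -ellU in vol.
pose beta (i : 'I_n.+1) := alpha i.+1 / (L * (u * ell i)).
have beta0 i : 0 < beta i by rewrite divr_gt0 ?alpha_gt0// !mulr_gt0.
have step k (kn : (k < n.+1)%N) :
    `|f - fn k| `^ (- (s / (s - 1))) +
    (2 * C * s) `^ (- (s / (s - 1) - 1)) * beta (Ordinal kn) `^ (s / (s - 1))
    <= `|f - fn k.+1| `^ (- (s / (s - 1))).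
  have [h gh hle] := ellg (Ordinal kn).
  apply: (greedy_step s C s1 C0 smooth _ _ _ _ L1_fin alpha_gt0 _ _ _ run) gh _ hle.
  - exact: leq_trans nN.
  - exact: (greedy_residual_gt0 _ _ _ _ _ _ _ run _ nN res_gt0).
  - by rewrite mulr_gt0.
have total : (2 * C * s) `^ (- (s / (s - 1) - 1)) *
    (\sum_i beta i `^ (s / (s - 1))) <= `|f - fn n.+1| `^ (- (s / (s - 1))).
  have partial k (kn : (k <= n.+1)%N) : (2 * C * s) `^ (- (s / (s - 1) - 1)) *
      (\sum_(i < k) beta (widen_ord kn i) `^ (s / (s - 1)))
      <= `|f - fn k| `^ (- (s / (s - 1))).
    elim: k kn => [|k IH] kn; first by rewrite big_ord0 mulr0 powR_ge0.
    apply: le_trans (step _ kn); rewrite big_ord_recr/= mulrDr lerD//.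
      apply: le_trans (IH (ltnW kn)); rewrite le_eqVlt; apply/orP; left; apply/eqP.
      by congr (_ * _); apply: eq_bigr => i _; congr (beta _ `^ _); exact/val_inj.
    rewrite le_eqVlt; apply/orP; left; apply/eqP.
    by congr (_ * beta _ `^ _); exact/val_inj.
  apply: le_trans (partial _ (leqnn _)).
  rewrite le_eqVlt; apply/orP; left; apply/eqP.
  by congr (_ * _); apply: eq_bigr => i _; congr (beta _ `^ _); exact/val_inj.
apply: le_trans (rate_of_sum _ _ _ _ _ s1 C0 res_gt0 beta0 total) _.
set pa := \prod_(i < n.+1) alpha i.+1; set pl := \prod_i ell i in vol.
have pa0 : 0 < pa by apply: prodr_gt0 => i _; exact: alpha_gt0.
have pl0 : 0 < pl by apply: prodr_gt0 => i _; exact: ell0.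
have n0 : n.+1%:R != 0 :> R by rewrite pnatr_eq0.
have -> : (\prod_i beta i) `^ (- n.+1%:R^-1) =
    pa `^ (- n.+1%:R^-1) * (L * u) * pl `^ n.+1%:R^-1.
  have -> : \prod_i beta i = pa * ((L * u) ^+ n.+1 * pl)^-1.
    rewrite /beta big_split/= -/pa; congr (_ * _); rewrite prodfV; congr (_^-1).
    under eq_bigr do rewrite mulrA.
    by rewrite big_split/= prodr_const card_ord.
  have Lu0 : 0 < L * u by rewrite mulr_gt0.
  rewrite powRM ?invr_ge0 ?(ltW pa0) ?mulr_ge0 ?exprn_ge0 ?(ltW Lu0) ?(ltW pl0)//.
  rewrite -mulrA; congr (_ * _).
  rewrite powRV ?mulr_ge0 ?exprn_ge0 ?(ltW Lu0) ?(ltW pl0)// powRN invrK.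
  rewrite powRM ?exprn_ge0 ?(ltW Lu0) ?(ltW pl0)//; congr (_ * _).
  by rewrite -powR_mulrn ?(ltW Lu0)// -powRrM mulfV// powRr1// ltW.
have const := smoothness_constant s C s12 C0.
set x1 := (2 * C * s) `^ s^-1 in const *; set x2 := n.+1%:R `^ (s^-1 - 1).
set x3 := pa `^ _; set x4 := (_ * unit_ball_volume _ _) `^ _ in vol *.
set x5 := 2 `^ (1 + s^-1) * C `^ s^-1 in const *.
have x20 : 0 <= x2 by exact: powR_ge0.
have x30 : 0 <= x3 by exact: powR_ge0.
have x40 : 0 <= x4 by exact: powR_ge0.
have x10 : 0 <= x1 by exact: powR_ge0.
apply: (@le_trans _ _ (x1 * x2 * (x3 * (L * u) * (x4 * (Num.sqrt 2 * (t * e)))))).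
  by rewrite ler_wpM2l ?mulr_ge0// ler_wpM2l// !mulr_ge0// ltW.
have -> : x1 * x2 * (x3 * (L * u) * (x4 * (Num.sqrt 2 * (t * e)))) =
  x1 * Num.sqrt 2 * (x2 * x3 * (L * u) * (x4 * (t * e))) by ring.
have -> : x5 * x3 * (x2 * x4) * L * e * (t * u) =
  x5 * (x2 * x3 * (L * u) * (x4 * (t * e))) by ring.
by rewrite ler_wpM2r// !mulr_ge0// ltW.
Qed.

End greedy_rate.

(** * Entropy numbers are positive and finite *)

Section entropy.
Context {R : realType} {X : normedModType R}.

(** The segment from [0] to [x] lies in the hull and carries [2 ^ n + 1]
    equidistant points, two of which share a ball. *)
Lemma entropy_number_gt0 n (K : set X) (x : X) : K x -> x != 0 ->
  (0 < entropy_number n (sym_convex_hull K))%E.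
Proof.
move=> Kx x0; have nx : 0 < `|x| by rewrite normr_gt0.
have N0 : 0 < (2 ^ n)%:R :> R by rewrite ltr0n expn_gt0.
apply: (@lt_le_trans _ _ (`|x| / (2 ^ n)%:R / 2)%:E).
  by rewrite lte_fin !divr_gt0.
apply/ereal_infP => _ [e [e0 [c cover]] <-]; rewrite lee_fin.
pose y (k : 'I_(2 ^ n).+1) : X := (k%:R / (2 ^ n)%:R : R) *: x.
have ball_of k : exists j, ball (c j) e (y k).
  have : sym_convex_hull K (y k).
    apply: subset_closure; exists 1%N, (fun=> k%:R / (2 ^ n)%:R), (fun=> x).
    split=> //; rewrite big_ord1// ger0_norm ?divr_ge0//.
    by rewrite ler_pdivrMr// mul1r ler_nat -ltnS.
  by move/cover => [j _ yj]; exists j.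
have [j jP] := choice ball_of.
have [k [l [kl jkl]]] : exists k l, k != l /\ j k = j l.
  apply: contrapT => inj.
  have : injective j.
    move=> k l jkl; apply/eqP; apply: contrapT => /negP kl; apply: inj.
    by exists k, l.
  by move/leq_card; rewrite !card_ord ltnn.
have : `|y k - y l| < 2 * e.
  have -> : y k - y l = (y k - c (j k)) + (c (j k) - y l) by rewrite addrA subrK.
  apply: le_lt_trans (ler_normD _ _) _.
  have := jP k; have := jP l; rewrite -jkl -!ball_normE/= [X in _ -> X < _ -> _]distrC.
  by rewrite [2 * e]mulr_natl mulr2n => h1 h2; exact: ltrD.
rewrite -scalerBl -mulrBl normrZ normrM normfV.
have kl1 : 1 <= `|k%:R - l%:R : R|.
  move: kl; rewrite -val_eqE/= neq_ltn => /orP[] kl.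
    rewrite distrC ger0_norm ?subr_ge0 ?ler_nat ?(ltnW kl)//.
    by rewrite lerBrDr nat1r ler_nat.
  rewrite ger0_norm ?subr_ge0 ?ler_nat ?(ltnW kl)//.
  by rewrite lerBrDr nat1r ler_nat.
rewrite (gtr0_norm N0) => small.
rewrite ler_pdivrMr// [e * 2]mulrC; apply: le_trans (ltW small).
by rewrite -mulrA [_^-1 * _]mulrC -[leLHS]mul1r ler_wpM2r.
Qed.

(** [K] is bounded, hence so is its hull, and copies of one large ball
    suffice. *)
Lemma entropy_number_fin n (K : set X) : compact K ->
  exists2 e : R, 0 < e &
  exists c : 'I_(2 ^ n) -> X, sym_convex_hull K `<=` \bigcup_i ball (c i) e.
Proof.
move=> /compact_bounded[M [_ KM]].
have {}KM h : K h -> `|h| <= `|M| + 1.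
  by apply: KM; rewrite (le_lt_trans (ler_norm M))// ltrDl.
exists (`|M| + 3); first by rewrite ltr_wpDl.
exists (fun=> 0) => x hx; have i0 : 'I_(2 ^ n) by apply: Ordinal (expn_gt0 2 n).
exists i0 => //; rewrite -ball_normE/= sub0r normrN.
have [y [/= [m [c [h [hK c1 yE]]]] xy]] := hx _ (nbhsx_ballx x 1 ltr01).
have ny : `|y| <= `|M| + 1.
  rewrite yE; apply: le_trans (ler_norm_sum _ _ _) _.
  apply: (@le_trans _ _ (\sum_(i < m) `|c i| * (`|M| + 1))).
    by apply: ler_sum => i _; rewrite normrZ ler_wpM2l// KM.
  by rewrite -mulr_suml -[leRHS]mul1r ler_wpM2r// addr_ge0.
have -> : x = (x - y) + y by rewrite subrK.
apply: le_lt_trans (ler_normD _ _) _.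
move: xy; rewrite -ball_normE/= => xy.
lra.
Qed.

End entropy.

(** * The theorem *)

Theorem theorem4p1 (R : realType) (X : completeNormedModType R) (s CX : R)
  (hs : 1 < s <= 2) (hCX : 0 < CX)
  (hrho : forall t : R, 0 < t ->
     (modulus_of_smoothness X t <= (CX * t `^ s)%:E)%E)
  (K : set X) (hK0 : K !=set0) (hK : compact K)
  (alpha : nat -> R)
  (halpha : forall n : nat, (1 <= n)%N -> 0 < alpha n <= 1)
  (f : X) (hf : (L1_norm K f < +oo)%E)
  (N : nat) (F : nat -> {linear X -> R^o}) (g fn : nat -> X)
  (hrun : WCGA_run K f N alpha F g fn)
  (n : nat) (hn : (1 <= n <= N)%N) :
  (`|f - fn n|%:E <=
    (2 `^ (1 + s^-1) * CX `^ s^-1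
       * (\prod_(1 <= i < n.+1) alpha i) `^ (- n%:R^-1))%:E
    * delta X n
    * (n%:R `^ (s^-1 - 1) * (n`!%:R * unit_ball_volume R n) `^ n%:R^-1)%:E
    * L1_norm K f
    * entropy_number n (sym_convex_hull K))%E.
Proof.
case: n hn => [//|n] /= nN.
have alpha_gt0 m : (1 <= m)%N -> 0 < alpha m by move=> /halpha/andP[].
rewrite big_add1/= big_mkord.
set A := (X in (X%:E * delta _ _)%E); set B := (X in (_ * X%:E * L1_norm _ _)%E).
have A0 : 0 < A.
  rewrite !mulr_gt0 ?powR_gt0// prodr_gt0// => i _; exact: alpha_gt0.
have B0 : 0 < B.
  by rewrite !mulr_gt0 ?powR_gt0// mulr_gt0 ?unit_ball_volume_gt0// ltr0n fact_gt0.
have delta0 : (0 <= delta X n.+1)%E by apply: ereal_sup_ubound; left.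
have L1ge0 : (0 <= L1_norm K f)%E.
  apply/ereal_infP => z [[m [c [h [_ _ ->]]]]|[c [h [_ _ ->]]]].
    by rewrite lee_fin sumr_ge0.
  by apply: nneseries_ge0 => i _ _; rewrite lee_fin.
have eps0 : (0 <= entropy_number n.+1 (sym_convex_hull K))%E.
  by apply/ereal_infP => _ [e [e0 _] <-]; rewrite lee_fin ltW.
have rhs0 : (0 <= A%:E * delta X n.+1 * B%:E * L1_norm K f *
    entropy_number n.+1 (sym_convex_hull K))%E.
  by rewrite !mule_ge0// lee_fin ltW.
(* For a vanishing residual the selected elements may be dependent, but the
   claim is trivial. *)
have [res_le0|res_gt0] := leP `|f - fn n.+1| 0.
  by apply: le_trans rhs0; rewrite lee_fin.
set b := fun i : 'I_n.+1 => g i.+1.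
have free := greedy_basis_free s CX hs hCX hrho K f N alpha hf alpha_gt0 F g fn
  hrun n nN res_gt0.
have bK := greedy_basis_mem K f N alpha F g fn hrun n nN.
have L0 := greedy_L1_gt0 s CX hs hCX hrho K f N alpha hf alpha_gt0 F g fn
  hrun n nN res_gt0.
have Lfin : L1_norm K f \is a fin_num by rewrite ge0_fin_numE.
rewrite -(fineK Lfin); set L := fine _ in L0 *.
have dist_delta : (distance_to_l2 n.+1 (family_span b) <= delta X n.+1)%E.
  apply: ereal_sup_ubound; right; exists (family_span b) => //.
  by exists b; split.
have P0 e : 0 < e -> 0 < A * B * L * e.
  by move=> e0; exact: mulr_gt0 (mulr_gt0 (mulr_gt0 A0 B0) L0) e0.
have bound (e : R) : 0 < e ->
    (exists c : 'I_(2 ^ n.+1) -> X, sym_convex_hull K `<=` \bigcup_i ball (c i) e) ->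
    ((`|f - fn n.+1| / (A * B * L * e))%:E <= delta X n.+1)%E.
  move=> e0 [c cover]; apply: le_trans dist_delta.
  apply/ereal_infP => _ [T [S [iso ->]]].
  apply: (norm_product_ge _ _ _ _ (family_span0 _ b) (family_span_lin _ b) iso) => //.
  move=> t u t0 u0 tE uE; rewrite ler_pdivrMr ?P0// [leRHS]mulrC.
  exact: (greedy_rate s CX hs hCX hrho K f N alpha hf alpha_gt0 F g fn
    hrun n nN res_gt0 T S t u e c).
have [e1 e10 cover1] := entropy_number_fin n.+1 K hK.
have b0_neq0 : b ord0 != 0.
  apply/eqP => b00; suff : ((ord0 : 'I_n.+1) == ord0)%:R = 0 :> R.
    by move/eqP; rewrite eqxx oner_eq0.
  apply: (free (fun i => (i == ord0)%:R)).
  rewrite (bigD1 ord0)//= -/(b ord0) b00 scaler0 big1 ?addr0// => i /negbTE ->.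
  by rewrite scale0r.
have eps_gt0 := entropy_number_gt0 n.+1 K _ (bK ord0) b0_neq0.
have eps_fin : entropy_number n.+1 (sym_convex_hull K) \is a fin_num.
  rewrite ge0_fin_numE//; apply: le_lt_trans (ltry e1).
  by apply: ereal_inf_lbound; exists e1.
(* An infinite [delta] makes the right-hand side infinite because the entropy
   number is positive. *)
move: bound delta0; case: (delta X n.+1) => [d| |//] bound d0; last first.
  rewrite gt0_muley ?lte_fin// gt0_mulye ?lte_fin// gt0_mulye ?lte_fin//.
  by rewrite (gt0_mulye eps_gt0); exact: leey.
have d_gt0 : 0 < d.
  have := bound e1 e10 cover1; rewrite lee_fin; apply: lt_le_trans.
  by rewrite divr_gt0// P0.
have c_gt0 : 0 < A * d * B * L.
  exact: mulr_gt0 (mulr_gt0 (mulr_gt0 A0 d_gt0) B0) L0.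
rewrite -(fineK eps_fin) -!EFinM lee_fin mulrC -ler_pdivrMr// -lee_fin fineK//.
apply/ereal_infP => _ [e [e0 cover] <-].
have := bound e e0 cover; rewrite !lee_fin ler_pdivrMr ?P0// => h.
rewrite ler_pdivrMr//; apply: le_trans h _.
by rewrite le_eqVlt; apply/orP; left; apply/eqP; ring.
Qed.
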